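(* Let $j\geq 2$ be an integer and let $T$ be a tree of order $n>10j$. Then $m_T(\mu_2)=\lfloor\frac{n}{2}\rfloor-j$ if and only if $T\cong T\!\left(\lceil\frac{n}{2}\rceil+j-2,\ \lfloor\frac{n}{2}\rfloor-j+1\right)$, where $\mu_2=\mu_2(T)$ is the algebraic connectivity of $T$.
   Context: For a graph $G$ on $n$ vertices, the Laplacian matrix is $L(G)=D(G)-A(G)$, with $D(G)$ the diagonal degree matrix and $A(G)$ the adjacency matrix. Its eigenvalues are denoted $0=\mu_1(G)\leq\mu_2(G)\leq\cdots\leq\mu_n(G)$; $\mu_2(G)$ is the algebraic connectivity, and $m_G(\mu)$ denotes the multiplicity of $\mu$ as an eigenvalue of $L(G)$. For integers $1\leq k\leq s$, the spider $T(s,k)$ is the tree obtained from the star $K_{1,s}$ by extending $k$ of its $s$ rays by one extra edge each; it has $s+k+1$ vertices. *)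

(* Defs.v *)
From mathcomp Require Import all_boot all_order all_algebra.
From mathcomp.real_closed Require Import polyrcf.
Set Implicit Arguments. Unset Strict Implicit. Unset Printing Implicit Defensive.
Import Order.TTheory GRing.Theory Num.Theory.
Local Open Scope ring_scope.

Definition simple_graph (n : nat) (A : rel 'I_n) : Prop :=
  (forall x y, A x y = A y x) /\ (forall x, ~~ A x x).

Definition connected_graph (n : nat) (A : rel 'I_n) : Prop :=
  forall x y, connect A x y.

Definition acyclic_graph (n : nat) (A : rel 'I_n) : Prop :=
  forall c : seq 'I_n, uniq c -> (2 < size c)%N -> ~~ cycle A c.

Definition is_tree (n : nat) (A : rel 'I_n) : Prop :=
  [/\ (0 < n)%N, simple_graph A, connected_graph A & acyclic_graph A].

Definition laplacian (R : rcfType) (n : nat) (A : rel 'I_n) : 'M[R]_n :=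
  \matrix_(i, k) ((if i == k then (#|[set l | A i l]|)%:R else 0) - (A i k)%:R).

Definition lap_charpoly (R : rcfType) (n : nat) (A : rel 'I_n) : {poly R} :=
  char_poly (laplacian R A).

Definition lap_mult (R : rcfType) (n : nat) (A : rel 'I_n) (mu : R) : nat :=
  mup mu (lap_charpoly R A).

(* Laplacian spectrum, listed in nondecreasing order with multiplicities:
   mu_1 <= mu_2 <= ... <= mu_n. *)
Definition lap_spectrum (R : rcfType) (n : nat) (A : rel 'I_n) : seq R :=
  flatten [seq nseq (lap_mult A x) x | x <- rootsR (lap_charpoly R A)].

Definition lap_eig (R : rcfType) (n : nat) (A : rel 'I_n) (i : nat) : R :=
  nth 0 (lap_spectrum R A) i.-1.

Definition alg_conn (R : rcfType) (n : nat) (A : rel 'I_n) : R := lap_eig R A 2.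

Definition isomorphic (n m : nat) (A : rel 'I_n) (B : rel 'I_m) : Prop :=
  exists f : 'I_n -> 'I_m, bijective f /\ forall x y, A x y = B (f x) (f y).

(* Spider T(s,k) on vertex set 'I_(s+k+1): vertex 0 is the centre,
   vertices 1..s are the neighbours of the centre, and for 1 <= i <= k the
   vertex s+i is a pendant vertex attached to vertex i. *)
Definition spider_edge (s k u v : nat) : bool :=
  ((u == 0%N) && (1 <= v <= s)%N) || ((s < v)%N && (v - s == u)%N && (1 <= u <= k)%N).

Definition spider (s k : nat) : rel 'I_(s + k + 1) :=
  fun x y => spider_edge s k x y || spider_edge s k y x.
Arguments spider s k : clear implicits.

(* Main.v *)
Require Import Defs.
From mathcomp Require Import all_boot all_order all_algebra perm.
From mathcomp.real_closed Require Import polyrcf complex.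
From mathcomp Require Import ring lra zify.
From Stdlib Require Import Classical.

(* Let [mu] be the algebraic connectivity and [E] its eigenspace.  Two
   nonnegative functions on disjoint, non-adjacent vertex sets cannot both have
   Rayleigh quotient at most [mu], one of them strictly.  When [dim E >= 3] this
   yields a vertex [v] such that every function vanishing at [v] has Rayleigh
   quotient at least [mu].  Then the elements of [E] vanishing at [v] minimise
   the Rayleigh quotient on each branch at [v], so they are determined by their
   values at the neighbours of [v], while the indicator of a branch [B] gives
   [mu * #|B| <= 1].  Since [dim E] is close to [n / 2], some element of [E]
   vanishing at [v] lives on a branch with at most two vertices; hence [mu = 1]
   or [mu ^+ 2 - 3 * mu + 1 = 0], so [mu > 1 / 3] and all branches have at most
   two vertices.  The tree is thus a spider, and for [k > 0] the roots of
   [X ^ 2 - 3 * X + 1] have multiplicity [k - 1] in the spectrum of T(s, k).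
   Conversely, for [k > 1] an eigenfunction of T(s, k) for an eigenvalue below
   the smaller root has constant sign, so that root is the algebraic
   connectivity. *)

Set Implicit Arguments. Unset Strict Implicit. Unset Printing Implicit Defensive.
Import Order.TTheory GRing.Theory Num.Theory.
Local Open Scope ring_scope.
Local Open Scope sesquilinear_scope.

(** * Spectral theorem for symmetric matrices over a real closed field *)

(** Taking determinants in [P (X - A) = (X - D) P] and cancelling the nonzero constant [det P]
    avoids inverting [P] over the polynomials. *)
Lemma char_poly_conj (F : fieldType) (n : nat) (P A D : 'M[F]_n) :
  P \in unitmx -> P *m A = D *m P -> char_poly A = char_poly D.
Proof.
move=> Pu PAD; have detP : \det (map_mx polyC P) != 0.
  by rewrite det_map_mx polyC_eq0 -unitfE -unitmxE.
apply: (mulfI detP); rewrite [RHS]mulrC /char_poly -!det_mulmx; congr (\det _).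
rewrite /char_poly_mx mulmxBr mulmxBl -!map_mxM PAD.
by rewrite mul_mx_scalar mul_scalar_mx.
Qed.

(** Over [R[i]] the matrix is Hermitian, so it has a unitary diagonalisation with real eigenvalues.
    A complex [P] suffices, since ranks and characteristic polynomials descend to [R]. *)
Lemma hermitian_spectral (R : rcfType) (n : nat) (M : 'M[R]_n) : M^T = M ->
  exists (P : 'M[R[i]]_n) (d : 'rV[R]_n),
    P \is unitarymx /\
    P *m map_mx (real_complex R) M = diag_mx (map_mx (real_complex R) d) *m P.
Proof.
move=> Msym; set C := map_mx _ M.
have Creal : C \is a realmx.
  by apply/mxOverP => i k; rewrite !mxE; apply/complex_realP; exists (M i k).
have Csym : C \is symmetricmx.
  apply/is_hermitianmxP; rewrite /= expr0 scale1r map_mx_id //.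
  by rewrite map_trmx Msym.
have Cherm := realsym_hermsym Csym Creal.
have /orthomx_spectralP Ceq := hermitian_normalmx Cherm.
have /mxOverP dreal := hermitian_spectral_diag_real Cherm.
exists (spectralmx C), (map_mx (@complex.Re R) (spectral_diag C)).
split; first exact: spectral_unitarymx.
rewrite [X in _ *m X]Ceq !mulmxA mulmxV ?spectral_unit // mul1mx.
congr (diag_mx _ *m _); apply/rowP => k; rewrite !mxE.
by have /complex_realP[x ->] := dreal 0 k.
Qed.

(** Rows outside [S] vanish, which bounds the rank above; the minor on [S] is invertible, which
    bounds it below. *)
Lemma mxrank_diag (F : fieldType) (n : nat) (d : 'rV[F]_n) :
  \rank (diag_mx d) = #|[set k | d 0 k != 0]|.
Proof.
set S := [set _ | _]; pose f (j : 'I_#|S|) : 'I_n := enum_val j.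
have df j : d 0 (f j) != 0 by have := enum_valP j; rewrite inE.
apply/eqP; rewrite eqn_leq; apply/andP; split.
  apply: leq_trans (rank_leq_row (rowsub f (diag_mx d))); apply: mxrankS.
  apply/row_subP => i; have [di0|diN0] := eqVneq (d 0 i) 0.
    have -> : row i (diag_mx d) = 0 by rewrite row_diag_mx di0 scale0r.
    exact: sub0mx.
  have iS : i \in S by rewrite inE.
  rewrite -[i in row i _](enum_rankK_in iS iS) -/(f _) -row_rowsub.
  exact: row_sub.
have Du : diag_mx (colsub f d) \in unitmx.
  rewrite unitmxE det_diag unitfE; apply/prodf_neq0 => j _; rewrite mxE.
  exact: df.
have -> : #|S| = \rank (diag_mx (colsub f d)) by rewrite (mxrank_unit Du).
have -> : diag_mx (colsub f d) = colsub f (rowsub f (diag_mx d)).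
  by apply/matrixP => i k; rewrite !mxE (inj_eq enum_val_inj).
rewrite -[rowsub f _]mulmx1 -mulmx_colsub.
exact: leq_trans (mxrankM_maxl _ _) (mxrankS (rowsub_sub _ _)).
Qed.

(** The same diagonal entries count algebraic and geometric multiplicities, hence their equality in
    [mup_symmetric]. *)
Lemma char_poly_symmetric (R : rcfType) (n : nat) (M : 'M[R]_n) : M^T = M ->
  exists d : 'rV[R]_n, char_poly M = \prod_k ('X - (d 0 k)%:P) /\
    forall a, \rank (eigenspace M a) = #|[set k | d 0 k == a]|.
Proof.
move=> /hermitian_spectral[P [d [/unitarymx_unit Pu PM]]]; exists d; split.
  apply: (map_poly_inj (real_complex R)); rewrite map_char_poly.
  rewrite (char_poly_conj Pu PM) -map_diag_mx -map_char_poly; congr map_poly.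
  rewrite char_poly_trig ?diag_mx_is_trig //.
  by apply: eq_bigr => k _; rewrite mxE eqxx mulr1n.
move=> a; rewrite /eigenspace mxrank_ker -(mxrank_map (real_complex R)).
set A := map_mx _ (_ - _).
have PA : P *m A = map_mx (real_complex R) (diag_mx (d - const_mx a)) *m P.
  rewrite /A [diag_mx _]raddfB /= diag_const_mx !map_mxB mulmxBl mulmxBr PM.
  by rewrite map_diag_mx map_scalar_mx mul_mx_scalar mul_scalar_mx.
have -> : \rank A = \rank (P *m A).
  by rewrite (eqmxMfull _ (_ : row_full P)) // row_full_unit.
rewrite PA mxrankMfree ?row_free_unit // mxrank_map mxrank_diag.
rewrite [RHS]cardsCs card_ord; congr (_ - _)%N.
by apply: eq_card => k; rewrite !inE !mxE subr_eq0.
Qed.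

Lemma mup_symmetric (R : rcfType) (n : nat) (M : 'M[R]_n) (a : R) :
  M^T = M -> mup a (char_poly M) = \rank (eigenspace M a).
Proof.
move=> /char_poly_symmetric[d [-> ->]].
have -> : \prod_k ('X - (d 0 k)%:P) =
    \prod_(y <- [seq d 0 k | k <- enum 'I_n]) ('X - y%:P).
  by rewrite big_map enumT.
rewrite mu_prod_XsubC count_map cardE -size_filter enumT.
by rewrite /enum_mem; congr size; apply: eq_filter => k; rewrite !inE.
Qed.

(** In the coordinates [y = x P^-1] the form is the sum of the [d k * |y k| ^ 2]. *)
Lemma symmetric_psd (R : rcfType) (n : nat) (M : 'M[R]_n) : M^T = M ->
  (forall a, eigenvalue M a -> 0 <= a) ->
  forall x : 'rV[R]_n, 0 <= (x *m M *m x^T) 0 0.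
Proof.
move=> Msym Mge0 x; have [P [d [Pun PM]]] := hermitian_spectral Msym.
have Pu := unitarymx_unit Pun.
have d_ge0 k : 0 <= d 0 k.
  apply: Mge0; rewrite eigenvalue_root_char.
  rewrite -(fmorph_root (real_complex R)) map_char_poly.
  rewrite (char_poly_conj Pu PM) -map_diag_mx -map_char_poly fmorph_root.
  rewrite char_poly_trig ?diag_mx_is_trig // (bigD1 k) //= rootM.
  by rewrite root_XsubC mxE eqxx mulr1n eqxx.
rewrite -(ler0c (R:=R)).
pose xC := map_mx (real_complex R) x; pose y := xC *m invmx P.
have -> : ((x *m M *m x^T) 0 0)%:C%C =
    (y *m diag_mx (map_mx (real_complex R) d) *m y ^t* ) 0 0.
  have -> : y ^t* = P *m xC^T.
    rewrite /y invmx_unitary // trmx_mul map_mxM trmxCK; congr (_ *m _).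
    by apply/matrixP => i k; rewrite !mxE; apply: conjc_real.
  rewrite mulmxA -(mulmxA _ _ P) -PM /y !mulmxA mulmxKV //.
  by rewrite /xC map_trmx -!map_mxM [in RHS]mxE.
rewrite mxE; apply: sumr_ge0 => k _; rewrite mul_mx_diag !mxE mulrAC.
by apply: mulr_ge0; rewrite ?mul_conjC_ge0 // lecR.
Qed.

(** * The Laplacian as an operator on functions *)

(** Vanishing on [D] amounts to [#|D|] linear conditions, the columns of [B], too few to kill a
    space of larger dimension. *)
Lemma exists_vanishing (F : fieldType) (m n : nat) (E : 'M[F]_(m, n))
    (D : {set 'I_n}) : (#|D| < \rank E)%N ->
  exists2 x : 'rV[F]_n, x != 0 & (x <= E)%MS /\ forall i, i \in D -> x 0 i = 0.
Proof.
move=> ltDE; pose B : 'M[F]_(n, #|D|) := colsub (@enum_val _ (mem D)) 1%:M.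
have rkcap : \rank (E :&: kermx B)%MS != 0%N.
  have := mxrank_mul_ker E B; have := rank_leq_col (E *m B); lia.
exists (nz_row (E :&: kermx B)%MS); first by rewrite nz_row_eq0 -mxrank_eq0.
have /submx_trans sub := nz_row_sub (E :&: kermx B)%MS.
split=> [|i iD]; first by apply: sub; apply: capmxSl.
have /sub_kermxP/rowP/(_ (enum_rank_in iD i)) := sub _ _ (capmxSr E (kermx B)).
by rewrite /B mulmx_colsub mulmx1 !mxE enum_rankK_in.
Qed.

Definition lapf (R : rcfType) (n : nat) (A : rel 'I_n) (f : 'I_n -> R) (i : 'I_n) : R :=
  \sum_k (A i k)%:R * (f i - f k).

(* Twice the Laplacian quadratic form: every edge is counted in both directions. *)
Definition energy (R : rcfType) (n : nat) (A : rel 'I_n) (f : 'I_n -> R) : R :=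
  \sum_i \sum_k (A i k)%:R * (f i - f k) ^+ 2.

Definition sqnorm (R : rcfType) (n : nat) (f : 'I_n -> R) : R := \sum_i f i ^+ 2.

Definition eigfun (R : rcfType) (n : nat) (A : rel 'I_n) (mu : R) (f : 'I_n -> R) : Prop :=
  forall i, lapf A f i = mu * f i.

Lemma sqnorm_gt0 (R : rcfType) (n : nat) (f : 'I_n -> R) i : f i != 0 -> 0 < sqnorm f.
Proof.
move=> fi; rewrite /sqnorm (bigD1 i) //= ltr_pwDl ?exprn_even_gt0 //.
by apply: sumr_ge0 => k _; apply: sqr_ge0.
Qed.

Lemma energy_ge0 (R : rcfType) (n : nat) (A : rel 'I_n) (f : 'I_n -> R) : 0 <= energy A f.
Proof.
by apply: sumr_ge0 => i _; apply: sumr_ge0 => k _; rewrite mulr_ge0 ?sqr_ge0.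
Qed.

(** Green's formula: separating the terms in [g i] and [g k] gives two sums that agree after
    exchanging [i] and [k]. *)
Lemma energy_bilin (R : rcfType) (n : nat) (A : rel 'I_n) (f g : 'I_n -> R) :
    symmetric A ->
  \sum_i \sum_k (A i k)%:R * ((f i - f k) * (g i - g k)) = 2 * \sum_i g i * lapf A f i.
Proof.
move=> Asym; rewrite mulr_natl mulr2n.
transitivity (\sum_i \sum_k (g i * ((A i k)%:R * (f i - f k))
                              + g k * ((A k i)%:R * (f k - f i)))).
  by apply: eq_bigr => i _; apply: eq_bigr => k _; rewrite [A k i]Asym; ring.
under eq_bigr => i _ do rewrite big_split /=.
rewrite big_split /= [X in _ + X]exchange_big /=.
by congr (_ + _); apply: eq_bigr => i _; rewrite /lapf mulr_sumr.
Qed.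

Lemma energyE (R : rcfType) (n : nat) (A : rel 'I_n) (f : 'I_n -> R) :
  symmetric A -> energy A f = 2 * \sum_i f i * lapf A f i.
Proof.
by move=> Asym; rewrite -energy_bilin.
Qed.

Lemma energy_eigfun (R : rcfType) (n : nat) (A : rel 'I_n) (mu : R) (f : 'I_n -> R) :
  symmetric A -> eigfun A mu f -> energy A f = 2 * mu * sqnorm f.
Proof.
move=> Asym fE; rewrite energyE // -mulrA /sqnorm [mu * _]mulr_sumr.
by congr (_ * _); apply: eq_bigr => i _; rewrite fE; ring.
Qed.

Lemma sum_lapf (R : rcfType) (n : nat) (A : rel 'I_n) (f : 'I_n -> R) :
  symmetric A -> \sum_i lapf A f i = 0.
Proof.
move=> Asym; have := energy_bilin f (fun=> 1) Asym.
rewrite big1 => [|i _]; last by rewrite big1 // => k _; rewrite subrr !mulr0.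
under [in X in _ = X]eq_bigr => i _ do rewrite mul1r.
by move/esym/eqP; rewrite mulf_eq0 pnatr_eq0 => /eqP.
Qed.

Lemma eigfun_sum0 (R : rcfType) (n : nat) (A : rel 'I_n) (mu : R) (f : 'I_n -> R) :
  symmetric A -> mu != 0 -> eigfun A mu f -> \sum_i f i = 0.
Proof.
move=> Asym mu0 fE; have := sum_lapf f Asym.
under eq_bigr => i _ do rewrite fE.
by rewrite -mulr_sumr => /eqP; rewrite mulf_eq0 (negPf mu0) => /eqP.
Qed.

Lemma laplacian_sym (R : rcfType) (n : nat) (A : rel 'I_n) :
  symmetric A -> (laplacian R A)^T = laplacian R A.
Proof.
move=> Asym; apply/matrixP => i k; rewrite !mxE Asym eq_sym.
by case: eqP => // ->.
Qed.

Lemma mul_laplacian (R : rcfType) (n : nat) (A : rel 'I_n) (x : 'rV[R]_n) i :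
  symmetric A -> (x *m laplacian R A) 0 i = lapf A (x 0) i.
Proof.
move=> Asym; rewrite mxE /lapf.
under eq_bigr => k _ do rewrite mxE mulrBr.
rewrite sumrB (bigD1 i) //= eqxx big1 ?addr0; last first.
  by move=> k /negPf->; rewrite mulr0.
under [in RHS]eq_bigr => k _ do rewrite mulrBr.
rewrite sumrB -mulr_suml -natr_sum mulrC; congr (_%:R * _ - _).
  by rewrite -sum1dep_card big_mkcond; apply: eq_bigr => k _; case: (A i k).
by apply: eq_bigr => k _; rewrite mulrC Asym.
Qed.

Lemma eigfunP (R : rcfType) (n : nat) (A : rel 'I_n) (mu : R) (x : 'rV[R]_n) :
  symmetric A -> (x <= eigenspace (laplacian R A) mu)%MS <-> eigfun A mu (x 0).
Proof.
move=> Asym; split=> [/eigenspaceP/rowP xE i|xE].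
  by have := xE i; rewrite mul_laplacian // mxE.
by apply/eigenspaceP/rowP => i; rewrite mul_laplacian // mxE.
Qed.

Lemma eigfun_exists (R : rcfType) (n : nat) (A : rel 'I_n) (mu : R) (D : {set 'I_n}) :
    symmetric A -> (#|D| < \rank (eigenspace (laplacian R A) mu))%N ->
  exists f, [/\ eigfun A mu f, exists i, f i != 0 & forall i, i \in D -> f i = 0].
Proof.
move=> Asym /exists_vanishing[x /rV0Pn[i xi] [xE xD]].
by exists (x 0); split=> //; [apply/eigfunP|exists i].
Qed.

Lemma rank_eig_le (R : rcfType) (n : nat) (A : rel 'I_n) (mu : R) (D : {set 'I_n}) :
    symmetric A ->
    (forall f, eigfun A mu f -> (forall i, i \in D -> f i = 0) -> forall i, f i = 0) ->
  (\rank (eigenspace (laplacian R A) mu) <= #|D|)%N.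
Proof.
move=> Asym H; rewrite leqNgt; apply/negP => /(eigfun_exists Asym)[f [fE [i fi] fD]].
by rewrite (H f fE fD) eqxx in fi.
Qed.

Lemma eigenvalue_eigfun (R : rcfType) (n : nat) (A : rel 'I_n) (mu : R) :
  symmetric A ->
  eigenvalue (laplacian R A) mu <-> exists2 f, eigfun A mu f & exists i, f i != 0.
Proof.
move=> Asym; split.
  rewrite /eigenvalue -mxrank_eq0 -lt0n => rk.
  have := @eigfun_exists R n A mu set0 Asym; rewrite cards0 => /(_ rk)[f [fE fi _]].
  by exists f.
move=> [f fE [i fi]]; apply/eigenvalueP; exists (\row_k f k).
  apply/rowP => k; rewrite mul_laplacian // !mxE -fE /lapf.
  by apply: eq_bigr => l _; rewrite !mxE.
by apply/rV0Pn; exists i; rewrite mxE.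
Qed.

(** The energy vanishes, so every edge term does, and connectivity spreads the equality. *)
Lemma eigfun0_const (R : rcfType) (n : nat) (A : rel 'I_n) (f : 'I_n -> R) :
  symmetric A -> connected_graph A -> eigfun A 0 f -> forall i k, f i = f k.
Proof.
move=> Asym Acon fE.
have E0 : energy A f = 0 by rewrite (energy_eigfun Asym fE) mulr0 mul0r.
have edge i k : A i k -> f i = f k.
  move=> Aik; move/eqP: E0; rewrite psumr_eq0; last first.
    by move=> l _; apply: sumr_ge0 => j _; rewrite mulr_ge0 ?sqr_ge0.
  move=> /allP/(_ i (mem_index_enum _)) /=; rewrite psumr_eq0; last first.
    by move=> j _; rewrite mulr_ge0 ?sqr_ge0.
  move=> /allP/(_ k (mem_index_enum _)) /=.
  by rewrite Aik mul1r sqrf_eq0 subr_eq0 => /eqP.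
move=> i k; have /connectP[p pth ->] := Acon i k.
elim: p i pth => //= l p IH i /andP[/edge -> /IH ->] //.
Qed.

(** Eigenvalues are nonnegative, [0] is simple by connectivity, and [n > 1] provides another one. So
    the sorted roots start with [0], which contributes one entry to the spectrum, and the second
    entry is the next root. *)
Lemma alg_conn_spec (R : rcfType) (n : nat) (A : rel 'I_n) :
    symmetric A -> connected_graph A -> (1 < n)%N ->
  [/\ 0 < alg_conn R A, eigenvalue (laplacian R A) (alg_conn R A) &
      forall a, eigenvalue (laplacian R A) a -> a = 0 \/ alg_conn R A <= a].
Proof.
move=> Asym Acon n_gt1; pose o := Ordinal (ltnW n_gt1).
set p := lap_charpoly R A; have pN0 : p != 0 by rewrite monic_neq0 ?char_poly_monic.
have rsE x : (x \in rootsR p) = eigenvalue (laplacian R A) x.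
  by rewrite eigenvalue_root_char -roots_on_rootsR.
have eig_ge0 a : eigenvalue (laplacian R A) a -> 0 <= a.
  move=> /(eigenvalue_eigfun _ Asym)[f fE [i fi]].
  have := energy_ge0 A f; rewrite (energy_eigfun Asym fE).
  by rewrite pmulr_lge0 ?(sqnorm_gt0 fi) // pmulr_rge0.
have eig0 : eigenvalue (laplacian R A) 0.
  apply/eigenvalue_eigfun => //; exists (fun=> 1); last by exists o; rewrite oner_eq0.
  by move=> i; rewrite mul0r /lapf big1 // => k _; rewrite subrr mulr0.
have rk0 : (\rank (eigenspace (laplacian R A) 0) <= 1)%N.
  rewrite -(cards1 o); apply: rank_eig_le => // f fE fo i.
  by rewrite (eigfun0_const Asym Acon fE i o) fo ?inE.
have multE a : lap_mult A a = \rank (eigenspace (laplacian R A) a).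
  by apply: mup_symmetric; apply: laplacian_sym.
have mult_gt0 a : eigenvalue (laplacian R A) a -> (0 < lap_mult A a)%N.
  by rewrite multE lt0n mxrank_eq0.
have [b eigb bN0] : exists2 b, eigenvalue (laplacian R A) b & b != 0.
  have [d [pE dE]] := char_poly_symmetric (laplacian_sym R Asym).
  (* Otherwise all [n > 1] diagonal entries would be zero and [0] would not be simple. *)
  have : exists k, d 0 k != 0.
    apply/existsP; apply: contraTT rk0; rewrite negb_exists dE -ltnNge => /forallP d0.
    rewrite (_ : [set _ | _] = setT) ?cardsT ?card_ord //.
    by apply/setP => k; rewrite !inE; have := d0 k; rewrite negbK.
  move=> [k dk]; exists (d 0 k) => //.
  by rewrite eigenvalue_root_char pE (bigD1 k) //= rootM root_XsubC eqxx.
have srs : sorted <%R (rootsR p) by apply: sorted_roots.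
rewrite /alg_conn /lap_eig /lap_spectrum -/p /=.
case: (rootsR p) rsE srs => [|z r] rsE /=; first by have := rsE 0; rewrite eig0.
move=> srs; have := order_path_min lt_trans srs => /allP zr.
have z0 : z = 0.
  apply/eqP; rewrite eq_le eig_ge0 -?rsE ?mem_head // andbT.
  by have := rsE 0; rewrite eig0 inE => /orP[/eqP <-|/zr /ltW].
rewrite {}z0 in rsE srs zr *.
have mult0 : lap_mult A (0 : R) = 1%N.
  by apply/eqP; rewrite eqn_leq mult_gt0 // multE rk0.
case: r rsE srs zr => [|y r] rsE srs zr.
  by have := rsE b; rewrite eigb inE (negPf bN0).
have eigy : eigenvalue (laplacian R A) y by rewrite -rsE !inE eqxx orbT.
rewrite mult0 /=; have := mult_gt0 y eigy; case: (lap_mult A y) => //= my _.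
split=> //; first by apply: zr; rewrite mem_head.
move=> a; rewrite -rsE !inE => /or3P[/eqP|/eqP->|ar]; [by left|by right|right].
move: srs => /= /andP[_ syr].
by have /allP/(_ a ar)/ltW := order_path_min lt_trans syr.
Qed.

(** * Rayleigh quotients and separated functions *)

(* Adding [mu / n] times the all-ones matrix to [L - mu] lifts the eigenvalue
   [- mu] of the constant vectors to [0], so the sum is positive semidefinite. *)
Lemma alg_conn_rayleigh (R : rcfType) (n : nat) (A : rel 'I_n) (f : 'I_n -> R) :
    symmetric A -> connected_graph A -> (1 < n)%N -> \sum_i f i = 0 ->
  2 * alg_conn R A * sqnorm f <= energy A f.
Proof.
move=> Asym Acon n_gt1 f0.
have [mu_gt0 _ mu_min] := alg_conn_spec R Asym Acon n_gt1.
set mu := alg_conn R A in mu_gt0 mu_min *.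
have n0 : n%:R != 0 :> R by rewrite pnatr_eq0; lia.
pose M := laplacian R A - mu%:M + const_mx (mu / n%:R).
have ME (x : 'rV[R]_n) i : (x *m M) 0 i =
    lapf A (x 0) i - mu * x 0 i + mu / n%:R * \sum_k x 0 k.
  rewrite mulmxDr mulmxBr mul_mx_scalar mxE mxE mul_laplacian // !mxE mulr_sumr.
  by congr (_ - _ + _); apply: eq_bigr => k _; rewrite mxE mulrC.
have Msym : M^T = M.
  by rewrite /M !raddfD raddfN /= laplacian_sym // tr_scalar_mx trmx_const.
have Mge0 a : eigenvalue M a -> 0 <= a.
  move=> /eigenvalueP[v vM /rV0Pn[i vi]]; rewrite leNgt; apply/negP => a_lt0.
  have vE k : lapf A (v 0) k - mu * v 0 k + mu / n%:R * (\sum_l v 0 l) = a * v 0 k.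
    by rewrite -ME vM mxE.
  (* Summing over [k] cancels the two terms in [mu], so [a < 0] times the sum of [v] is zero. *)
  have S0 : \sum_k v 0 k = 0.
    have : \sum_k (lapf A (v 0) k - mu * v 0 k + mu / n%:R * (\sum_l v 0 l))
         = a * \sum_k v 0 k by rewrite mulr_sumr; apply: eq_bigr => k _; rewrite vE.
    rewrite big_split sumrB /= sum_lapf // -mulr_sumr sumr_const card_ord -[_ *+ n]mulr_natr.
    rewrite (_ : mu / _ * _ * _ = mu * \sum_k v 0 k); last by field.
    rewrite sub0r addNr => /esym/eqP.
    by rewrite mulf_eq0 (lt_eqF a_lt0) => /eqP.
  have vE' : eigfun A (a + mu) (v 0).
    by move=> k; have := vE k; rewrite S0; lra.
  have : eigenvalue (laplacian R A) (a + mu).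
    by apply/eigenvalue_eigfun => //; exists (v 0) => //; exists i.
  (* An eigenvalue [a + mu < mu] can only be [0]; then [v] is constant, and having sum zero it
     vanishes. *)
  case/mu_min => [e|]; last by lra.
  rewrite e in vE'.
  have vconst k : v 0 k = v 0 i by apply: (eigfun0_const Asym Acon vE').
  move: S0; under eq_bigr => k _ do rewrite vconst.
  rewrite sumr_const card_ord => /eqP; rewrite mulrn_eq0 (negPf vi) orbF; lia.
have := symmetric_psd Msym Mge0 (\row_i f i).
rewrite mxE.
under eq_bigr => k _ do rewrite ME !mxE.
have -> : \sum_k (\row_i f i) 0 k = 0 by rewrite -[RHS]f0; apply: eq_bigr => k _; rewrite mxE.
rewrite energyE // /sqnorm => H; rewrite -subr_ge0.
have -> : 2 * (\sum_i f i * lapf A f i) - 2 * mu * (\sum_i f i ^+ 2) =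
  2 * \sum_i (lapf A f i - mu * f i) * f i.
  rewrite -mulrA -mulrBr mulr_sumr -sumrB; congr (_ * _).
  by apply: eq_bigr => k _; ring.
rewrite pmulr_rge0 //; move: H; congr (0 <= _); apply: eq_bigr => k _.
rewrite mulr0 addr0; congr ((_ - _) * _).
by apply: eq_bigr => l _; rewrite !mxE.
Qed.

(** No edge joins the two disjoint supports, so energies and norms of combinations have no cross
    terms. *)
Definition separated (R : rcfType) (n : nat) (A : rel 'I_n) (f g : 'I_n -> R) : Prop :=
  (forall i, f i = 0 \/ g i = 0) /\
  (forall i k, A i k -> f i = 0 /\ f k = 0 \/ g i = 0 /\ g k = 0).

Lemma energy_separated (R : rcfType) (n : nat) (A : rel 'I_n) (f g : 'I_n -> R) a b :
    separated A f g ->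
  energy A (fun i => a * f i + b * g i) = a ^+ 2 * energy A f + b ^+ 2 * energy A g.
Proof.
move=> [_ sep]; rewrite /energy !mulr_sumr -big_split; apply: eq_bigr => i _ /=.
rewrite !mulr_sumr -big_split; apply: eq_bigr => k _ /=.
case: (boolP (A i k)) => [/sep|_]; last by rewrite !mul0r !mulr0 addr0.
by rewrite !mul1r; case=> [[-> ->]|[-> ->]]; ring.
Qed.

Lemma sqnorm_separated (R : rcfType) (n : nat) (A : rel 'I_n) (f g : 'I_n -> R) a b :
    separated A f g ->
  sqnorm (fun i => a * f i + b * g i) = a ^+ 2 * sqnorm f + b ^+ 2 * sqnorm g.
Proof.
move=> [sep _]; rewrite /sqnorm !mulr_sumr -big_split; apply: eq_bigr => i _ /=.
by case: (sep i) => ->; ring.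
Qed.

Lemma energy_abs (R : rcfType) (n : nat) (A : rel 'I_n) (f : 'I_n -> R) :
  energy A (fun i => `|f i|) <= energy A f.
Proof.
apply: ler_sum => i _; apply: ler_sum => k _; apply: ler_wpM2l; first exact: ler0n.
rewrite -[X in _ <= X]real_normK ?num_real //.
rewrite -[X in X <= _]real_normK ?num_real // lerXn2r ?nnegrE //.
exact: ler_dist_dist.
Qed.

Lemma sqnorm_abs (R : rcfType) (n : nat) (f : 'I_n -> R) :
  sqnorm (fun i => `|f i|) = sqnorm f.
Proof. by apply: eq_bigr => i _; rewrite real_normK ?num_real. Qed.

(* A combination of [|f|] and [- |g|] orthogonal to the constants would
   violate the Rayleigh bound. *)
Lemma separated_rayleigh (R : rcfType) (n : nat) (A : rel 'I_n) (mu : R) (f g : 'I_n -> R) :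
    (forall h, \sum_i h i = 0 -> 2 * mu * sqnorm h <= energy A h) ->
    separated A f g -> (exists i, g i != 0) ->
    energy A f < 2 * mu * sqnorm f -> 2 * mu * sqnorm g < energy A g.
Proof.
move=> ray [sep1 sep2] [i gi] ltf; rewrite ltNge; apply/negP => leg.
pose F i := `|f i|; pose G i := `|g i|.
have sepFG : separated A F G.
  split=> [k|k l /sep2]; first by case: (sep1 k) => e; [left|right]; rewrite /F /G e normr0.
  by rewrite /F /G; case=> [[-> ->]|[-> ->]]; rewrite normr0; [left|right].
pose a := \sum_i F i; pose b := \sum_i G i.
have b_gt0 : 0 < b.
  rewrite /b (bigD1 i) //= ltr_pwDl ?normr_gt0 //.
  by apply: sumr_ge0 => k _; apply: normr_ge0.
have h0 : \sum_i (b * F i + - a * G i) = 0.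
  by rewrite big_split /= -!mulr_sumr -/a -/b; ring.
have := ray _ h0; rewrite (energy_separated _ _ sepFG) (sqnorm_separated _ _ sepFG).
rewrite /F /G !sqnorm_abs => H.
have := energy_abs A f; have := energy_abs A g => Eg Ef.
have : b ^+ 2 * energy A (fun i => `|f i|) < b ^+ 2 * (2 * mu * sqnorm f).
  by rewrite ltr_pM2l ?exprn_gt0 //; apply: le_lt_trans ltf.
have : (- a) ^+ 2 * energy A (fun i => `|g i|) <= (- a) ^+ 2 * (2 * mu * sqnorm g).
  by apply: ler_wpM2l; rewrite ?sqr_ge0 //; apply: le_trans leg.
lra.
Qed.

(* [S] is a union of branches at [v]. *)
Definition pendant (n : nat) (A : rel 'I_n) (v : 'I_n) (S : {set 'I_n}) : Prop :=
  v \notin S /\ forall x y, x \in S -> A x y -> y != v -> y \in S.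

Definition restr (R : rcfType) (n : nat) (S : {set 'I_n}) (f : 'I_n -> R) (i : 'I_n) : R :=
  if i \in S then f i else 0.

(** An edge leaves [S] only through [v], where both functions vanish. *)
Lemma pendant_separated (R : rcfType) (n : nat) (A : rel 'I_n) v S (f g : 'I_n -> R) :
    symmetric A -> pendant A v S ->
    (forall i, i \notin S -> f i = 0) -> (forall i, i \in S -> g i = 0) -> g v = 0 ->
  separated A f g.
Proof.
move=> Asym [vS pS] fS gS gv; split=> [i|i k Aik].
  by have [/gS|/fS] := boolP (i \in S); [right|left].
have gN i' k' : A i' k' -> i' \in S -> g i' = 0 /\ g k' = 0.
  move=> Aik' iS; split; first exact: gS.
  by have [->|/(pS i' k' iS Aik')/gS] := eqVneq k' v.
have [/(gN _ _ Aik)|iS] := boolP (i \in S); first by right.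
have [|kS] := boolP (k \in S); last by left; split; apply: fS.
by rewrite Asym in Aik; move/(gN _ _ Aik) => [-> ->]; right.
Qed.

Lemma pendantC (n : nat) (A : rel 'I_n) v S : symmetric A -> pendant A v S ->
  pendant A v (~: (v |: S)).
Proof.
move=> Asym [vS pS]; split=> [|x y]; first by rewrite !inE eqxx.
rewrite !inE !negb_or => /andP[xv xS] Axy yv; rewrite yv /=.
by apply: contra xS => yS; apply: (pS y x) => //; rewrite Asym.
Qed.

Lemma pendantI (n : nat) (A : rel 'I_n) v S T : pendant A v S -> pendant A v T ->
  pendant A v (S :&: T).
Proof.
move=> [vS pS] [vT pT]; split; first by rewrite inE (negPf vS).
move=> x y; rewrite !inE => /andP[xS xT] Axy yv.
by apply/andP; split; [apply: (pS x)|apply: (pT x)].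
Qed.

Lemma energy_split (R : rcfType) (n : nat) (A : rel 'I_n) v S (f : 'I_n -> R) :
    symmetric A -> pendant A v S -> f v = 0 ->
  energy A f = energy A (restr S f) + energy A (restr (~: S) f).
Proof.
move=> Asym pS fv.
have sep : separated A (restr S f) (restr (~: S) f).
  apply: (pendant_separated Asym pS) => [i /negPf|i|]; rewrite /restr ?inE.
  - by move=> ->.
  - by move=> ->.
  - by rewrite fv if_same.
have := energy_separated 1 1 sep; rewrite !expr1n !mul1r => <-.
apply: eq_bigr => i _; apply: eq_bigr => k _; congr (_ * (_ - _) ^+ 2);
  by rewrite /restr !inE; case: ifP; rewrite !mul1r ?addr0 ?add0r.
Qed.

Lemma sqnorm_split (R : rcfType) (n : nat) S (f : 'I_n -> R) :
  sqnorm f = sqnorm (restr S f) + sqnorm (restr (~: S) f).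
Proof.
rewrite /sqnorm -big_split; apply: eq_bigr => i _ /=; rewrite /restr !inE.
by case: ifP => _; rewrite /= expr0n ?addr0 ?add0r.
Qed.

(** Restriction does not change the Laplacian on [S]: the only possible neighbour outside [S] is
    [v], where [f] already vanishes. *)
Lemma eigfun_restr (R : rcfType) (n : nat) (A : rel 'I_n) (mu : R) v S (f : 'I_n -> R) :
    symmetric A -> pendant A v S -> eigfun A mu f -> f v = 0 ->
  energy A (restr S f) = 2 * mu * sqnorm (restr S f).
Proof.
move=> Asym [vS pS] fE fv; rewrite energyE // -mulrA /sqnorm [mu * _]mulr_sumr.
congr (_ * _); apply: eq_bigr => i _.
have [iS|iS] := boolP (i \in S); last by rewrite /restr (negPf iS) mul0r expr0n mulr0.
have -> : lapf A (restr S f) i = lapf A f i.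
  apply: eq_bigr => k _; have [Aik|_] := boolP (A i k); last by rewrite !mul0r.
  rewrite /restr iS; have [->|kv] := eqVneq k v; first by rewrite (negPf vS) fv.
  by rewrite (pS i k).
by rewrite fE /restr iS; ring.
Qed.

(** * Branches of a tree *)

(** Forbidding [v] at both ends of each step makes this, for [u != v], the component of [u] in the
    graph without [v]. *)
Definition branch (n : nat) (A : rel 'I_n) (v u : 'I_n) : {set 'I_n} :=
  [set w | connect (fun x y => [&& A x y, x != v & y != v]) u w].

Lemma branch_root (n : nat) (A : rel 'I_n) v u : u \in branch A v u.
Proof. by rewrite inE connect0. Qed.

Lemma branch_pendant (n : nat) (A : rel 'I_n) v u : u != v -> pendant A v (branch A v u).
Proof.
move=> uv; have notv w : w \in branch A v u -> w != v.
  rewrite inE => /connectP[p + ->]; elim/last_ind: p => [|p x _] //.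
  by rewrite rcons_path last_rcons => /andP[_ /and3P[]].
split=> [|x y xB Axy yv]; first by apply/negP => /notv; rewrite eqxx.
have xv := notv x xB; move: xB; rewrite !inE => /connect_trans; apply.
by apply: connect1; rewrite Axy xv.
Qed.

Lemma branch_ind (n : nat) (A : rel 'I_n) v u (P : 'I_n -> Prop) :
    P u -> (forall x y, P x -> A x y -> x != v -> y != v -> P y) ->
  forall w, w \in branch A v u -> P w.
Proof.
move=> Pu Pstep w; rewrite inE => /connectP[p pth ->].
elim: p u Pu pth => //= y p IH x Px /andP[/and3P[Axy xv yv]]; apply: IH.
exact: Pstep Px Axy xv yv.
Qed.

Lemma branch_sub (n : nat) (A : rel 'I_n) v u S :
  pendant A v S -> u \in S -> branch A v u \subset S.
Proof.
move=> [_ pS] uS; apply/subsetP; apply: branch_ind => // x y xS Axy _ yv.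
exact: pS xS Axy yv.
Qed.

(** A second neighbour of [v] in the branch would close a cycle through [v]. *)
Lemma branch_neighbor (n : nat) (A : rel 'I_n) v u w :
  is_tree A -> A v u -> w \in branch A v u -> A v w -> w = u.
Proof.
move=> [_ [Asym Airr] _ Aacy] Avu wB Avw; apply/eqP; apply: contraT => wu.
have uv : u != v by apply: contraTneq Avu => ->; apply: Airr.
move: wB; rewrite inE => /connectP[p0 /shortenP[p pth up _]] we.
have /Aacy : uniq (v :: u :: p).
  rewrite cons_uniq up andbT inE negb_or eq_sym uv /=.
  elim: p u pth {Avu uv wu up we} => //= x p IH u /andP[/and3P[_ _ xv] /IH].
  by rewrite inE negb_or eq_sym xv.
rewrite /= Avu /= rcons_path -we [A w v]Asym Avw andbT.
have -> : path A u p by apply: sub_path pth => x y /and3P[].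
by case: p we {pth up} => [we|x p _] /=; [rewrite we eqxx in wu|move=> /(_ isT)].
Qed.

(** By [branch_neighbor] only [u] is adjacent to [v] in its branch, so a step out of the rest of the
    branch can only reach [u]. *)
Lemma branch_inner_pendant (n : nat) (A : rel 'I_n) v u :
  is_tree A -> A v u -> pendant A u (branch A v u :\ u).
Proof.
move=> Atree Avu; have [_ [Asym Airr] _ _] := Atree.
have uv : u != v by apply: contraTneq Avu => ->; apply: Airr.
have [vB pB] := branch_pendant A uv.
split=> [|x y]; first by rewrite !inE eqxx.
rewrite !in_setD1 => /andP[xu xB] Axy yu; rewrite yu /=; apply: (pB x) => //.
apply: contraNneq xu => yv; rewrite yv Asym in Axy.
by apply/eqP; apply: (branch_neighbor Atree Avu).
Qed.

(** Here [u] is the first vertex after [v] on a simple path from [v] to [w]. *)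
Lemma branch_cover (n : nat) (A : rel 'I_n) v w :
  connected_graph A -> w != v -> exists2 u, A v u & w \in branch A v u.
Proof.
move=> Acon wv; have /connectP[p0 /shortenP[p pth up _]] := Acon v w.
case: p pth up => [|u p] /=; first by move=> _ _ e; rewrite e eqxx in wv.
move=> /andP[Avu pth] /andP[vp _] we; exists u => //.
rewrite inE; apply/connectP; exists p => //.
elim: p u pth vp {Avu we} => //= x p IH u /andP[Aux pth].
rewrite !inE !negb_or => /and3P[uv xv vp].
by rewrite Aux [u == v]eq_sym uv [x == v]eq_sym xv IH // inE negb_or xv.
Qed.

(** Otherwise [S] would be closed under adjacency, against connectivity. *)
Lemma pendant_neighbor (n : nat) (A : rel 'I_n) v S x :
  symmetric A -> connected_graph A -> pendant A v S -> x \in S -> exists2 u, u \in S & A v u.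
Proof.
move=> Asym Acon [vS pS] xS; apply: NNPP => nex.
have clS : closed A (mem S).
  apply: intro_closed => [|y z Ayz yS]; first exact: sym_connect_sym.
  apply: (pS y) => //; apply/negP => /eqP zv.
  by apply: nex; exists y => //; rewrite Asym -zv.
by move: vS; rewrite -[v \in S](closed_connect clS (Acon x v)) xS.
Qed.

(** * The central vertex and the eigenfunctions vanishing there *)

Lemma restr_notin (R : rcfType) (n : nat) (S : {set 'I_n}) (f : 'I_n -> R) i :
  i \notin S -> restr S f i = 0.
Proof. by rewrite /restr => /negPf->. Qed.

Lemma separatedC (R : rcfType) (n : nat) (A : rel 'I_n) (f g : 'I_n -> R) :
  separated A f g -> separated A g f.
Proof. by move=> [s1 s2]; split=> [i|i k /s2]; [case: (s1 i)|]; tauto. Qed.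

(* Call a function bad at [v] if it vanishes at [v] and its Rayleigh quotient is
   less than [mu].  If every vertex has a bad function, take one supported on
   the smallest possible pendant set and reduce to a branch [C] at [v] with
   root [u]; the bad function at [u] then lives outside [C].  As the eigenspace
   has dimension at least 3, some eigenfunction vanishes at both [u] and [v], and
   its part inside or outside [C] is separated from one of the two bad functions. *)
Lemma exists_center (R : rcfType) (n : nat) (A : rel 'I_n) (mu : R) :
    is_tree A ->
    (forall h, \sum_i h i = 0 -> 2 * mu * sqnorm h <= energy A h) ->
    (2 < \rank (eigenspace (laplacian R A) mu))%N ->
  exists v, forall f, f v = 0 -> 2 * mu * sqnorm f <= energy A f.
Proof.
move=> Atree ray rkE; have [n_gt0 [Asym Airr] Acon _] := Atree.
apply: NNPP => nex.
have bad v : exists2 f : 'I_n -> R, f v = 0 & energy A f < 2 * mu * sqnorm f.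
  apply: NNPP => nbad; apply: nex; exists v => f fv; rewrite leNgt.
  by apply/negP => flt; apply: nbad; exists f.
(* Induction on a bound for the size of [S] replaces the choice of a minimal pendant set; it is
   applied to the complement of one vertex. *)
suff min N v (S : {set 'I_n}) (f : 'I_n -> R) : (#|S| < N)%N -> pendant A v S ->
    (forall i, i \notin S -> f i = 0) -> ~ energy A f < 2 * mu * sqnorm f.
  pose v := Ordinal n_gt0; have [f fv flt] := bad v.
  apply: (min n.+1 v (~: [set v]) f) flt.
  - by rewrite ltnS -[X in (_ <= X)%N](card_ord n) max_card.
  - by split=> [|x y _ _]; rewrite !inE ?eqxx.
  - by move=> i; rewrite !inE negbK => /eqP->.
elim: N v S f => // N IH v S f cS pS fS flt.
have [vS _] := pS; have fv : f v = 0 by apply: fS.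
have [x xS] : exists x, x \in S.
  apply/set0Pn; apply: contraTneq flt => S0; rewrite -leNgt.
  have -> : sqnorm f = 0.
    by rewrite /sqnorm big1 // => i _; rewrite fS ?expr0n // S0 inE.
  by rewrite mulr0 energy_ge0.
have [u uS Avu] := pendant_neighbor Asym Acon pS xS.
have uv : u != v by apply: contraTneq Avu => ->; apply: Airr.
set C := branch A v u; have pC : pendant A v C := branch_pendant A uv.
have uC : u \in C := branch_root A v u; have vC : v \notin C by case: pC.
have CS : C \subset S := branch_sub pS uS.
have pC' : pendant A u (C :\ u) := branch_inner_pendant Atree Avu.
clearbody C; pose f1 := restr C f.
(* Otherwise the rest of [f] would be bad and live on [S] without [C], a smaller pendant set. *)
have f1lt : energy A f1 < 2 * mu * sqnorm f1.
  have pSC : pendant A v (S :&: ~: (v |: C)) by apply: pendantI => //; apply: pendantC.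
  rewrite ltNge; apply/negP => f1ge.
  apply: (IH v (S :&: ~: (v |: C)) (restr (~: C) f)) => //.
  - apply: leq_trans (_ : #|S| <= N)%N => //; apply: proper_card.
    apply/properP; split; first exact: subsetIl.
    by exists u => //; rewrite !inE uC orbT andbF.
  - move=> i; rewrite /restr !inE; have [->|iv] := eqVneq i v; first by rewrite fv if_same.
    by rewrite /= negb_and negbK; case: (i \in C) => //=; rewrite orbF => /fS.
  - move: flt; rewrite (energy_split Asym pC fv) (sqnorm_split C f) -/f1; lra.
have sCS : (#|C :\ u| < N)%N.
  apply: leq_trans (_ : #|S| <= N)%N => //.
  by apply: leq_trans (subset_leq_card CS); rewrite [X in (_ < X)%N](cardsD1 u) uC.
have [g gu glt] := bad u; pose g2 := restr (~: (C :\ u)) g.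
(* By induction the part of [g] on [C :\ u] is not bad, so the complementary part is. *)
have g2lt : energy A g2 < 2 * mu * sqnorm g2.
  have /negP := IH u (C :\ u) (restr (C :\ u) g) sCS pC' (fun i => @restr_notin R n _ g i).
  by move: glt; rewrite (energy_split Asym pC' gu) (sqnorm_split (C :\ u) g) -/g2; lra.
have [|h [hE [i hi] h0]] := @eigfun_exists R n A mu [set u; v] Asym.
  by rewrite cards2 uv.
have hu : h u = 0 by apply: h0; rewrite !inE eqxx.
have hv : h v = 0 by apply: h0; rewrite !inE eqxx orbT.
(* If [h] is nonzero somewhere on [C], its part there is separated from [g2]; otherwise [h] itself
   is separated from [f1]. *)
have [/existsP[k /andP[kC hk]]|/existsPn hC] := boolP [exists k, (k \in C) && (h k != 0)].
  have ku : k != u by apply: contraNneq hk => ->; rewrite hu.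
  have sep : separated A g2 (restr (C :\ u) h).
    apply: separatedC; apply: (pendant_separated Asym pC') => [l|l lC|].
    - exact: restr_notin.
    - by rewrite /g2 restr_notin // inE negbK.
    - by rewrite /g2 /restr gu if_same.
  have ex : exists l, restr (C :\ u) h l != 0 by exists k; rewrite /restr in_setD1 ku kC.
  by have := separated_rayleigh ray sep ex g2lt; rewrite (eigfun_restr Asym pC' hE hu) ltxx.
have sep : separated A f1 h.
  apply: (pendant_separated Asym pC) => [l|l lC|//]; first exact: restr_notin.
  by apply/eqP; have := hC l; rewrite lC negbK.
have ex : exists l, h l != 0 by exists i.
by have := separated_rayleigh ray sep ex f1lt; rewrite (energy_eigfun Asym hE) ltxx.
Qed.

(* [`|f|] minimises the Rayleigh quotient among the functions vanishing at [v]; if it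
   were positive at [w], increasing it slightly at [u] would lower the quotient. *)
Lemma center_propagate (R : rcfType) (n : nat) (A : rel 'I_n) (mu : R) v u w (f : 'I_n -> R) :
    symmetric A -> (forall f, f v = 0 -> 2 * mu * sqnorm f <= energy A f) ->
    eigfun A mu f -> f v = 0 -> u != v -> f u = 0 -> A u w -> f w = 0.
Proof.
move=> Asym good fE fv uv fu Auw; apply/eqP; apply: contraT => fw.
pose y i := `|f i|; pose d (i : 'I_n) : R := (i == u)%:R.
have dsum (g : 'I_n -> R) : \sum_i d i * g i = g u.
  rewrite (bigD1 u) //= /d eqxx mul1r big1 ?addr0 // => i /negPf->.
  by rewrite mul0r.
have dnorm : sqnorm d = 1.
  transitivity (\sum_i d i * d i); last by rewrite dsum /d eqxx.
  by apply: eq_bigr => i _; rewrite expr2.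
have yu : y u = 0 by rewrite /y fu normr0.
have c_lt0 : lapf A y u < 0.
  have -> : lapf A y u = - \sum_k (A u k)%:R * y k.
    by rewrite -sumrN; apply: eq_bigr => k _; rewrite yu sub0r mulrN.
  rewrite oppr_lt0 (bigD1 w) //= Auw mul1r ltr_pwDl ?normr_gt0 //.
  by apply: sumr_ge0 => k _; rewrite mulr_ge0 ?ler0n ?normr_ge0.
have dge : 2 * mu <= energy A d.
  by have := good d; rewrite dnorm mulr1; apply; rewrite /d eq_sym (negPf uv).
have perturb t : 2 * mu * t ^+ 2 <= 4 * t * lapf A y u + t ^+ 2 * energy A d.
  have := good (fun i => y i + t * d i).
  have -> : sqnorm (fun i => y i + t * d i) = sqnorm y + t ^+ 2.
    transitivity (sqnorm y + t ^+ 2 * sqnorm d + 2 * t * \sum_i d i * y i); last first.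
      by rewrite dsum dnorm yu; ring.
    rewrite /sqnorm !mulr_sumr -!big_split; apply: eq_bigr => i _ /=; ring.
  have -> : energy A (fun i => y i + t * d i) =
      energy A y + 4 * t * lapf A y u + t ^+ 2 * energy A d.
    have -> : 4 * t * lapf A y u = 2 * t * (2 * \sum_i d i * lapf A y i) by rewrite dsum; ring.
    rewrite -energy_bilin // /energy !mulr_sumr -!big_split; apply: eq_bigr => i _ /=.
    rewrite !mulr_sumr -!big_split; apply: eq_bigr => k _ /=; ring.
  have := energy_abs A f; rewrite (energy_eigfun Asym fE) -(sqnorm_abs f) -/y.
  move=> yle /(_ _); rewrite /y fv normr0 /d eq_sym (negPf uv) mulr0 addr0 => /(_ erefl).
  move: yle; rewrite /y -/d; lra.
(* With [c = lapf A y u], [K = energy A d - 2 * mu + 1] and [t = - c / K], the inequality reads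
   [0 <= - t ^+ 2 * (3 * K + 1)], which is absurd. The [+ 1] keeps [K] positive even when
   [energy A d = 2 * mu]. *)
move: c_lt0 dge (perturb (- lapf A y u / (energy A d - 2 * mu + 1))).
move: (lapf A y u) (energy A d) => c e c0 ge.
have : 0 < e - 2 * mu + 1 by lra.
set K := e - 2 * mu + 1 => K0; set t := - c / K.
have t0 : 0 < t by rewrite divr_gt0 // oppr_gt0.
have ct : c = - t * K by rewrite /t; field; rewrite gt_eqF.
have -> : e = K + 2 * mu - 1 by rewrite /K; ring.
rewrite {1}ct; have := mulr_gt0 t0 t0; have := mulr_gt0 (mulr_gt0 t0 t0) K0; lra.
Qed.

Lemma center_branch_zero (R : rcfType) (n : nat) (A : rel 'I_n) (mu : R) v u (f : 'I_n -> R) :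
    symmetric A -> (forall f, f v = 0 -> 2 * mu * sqnorm f <= energy A f) ->
    eigfun A mu f -> f v = 0 -> f u = 0 ->
  forall w, w \in branch A v u -> f w = 0.
Proof.
move=> Asym good fE fv fu; apply: branch_ind => // x y fx Axy xv _.
exact: center_propagate good fE fv xv fx Axy.
Qed.

(** The indicator of the branch serves as test function: its only boundary edge joins [v] and [u],
    and [energy] counts it twice. *)
Lemma center_branch_card (R : rcfType) (n : nat) (A : rel 'I_n) (mu : R) v u :
    is_tree A -> (forall f, f v = 0 -> 2 * mu * sqnorm f <= energy A f) -> A v u ->
  mu * #|branch A v u|%:R <= 1.
Proof.
move=> Atree good Avu; have [_ [Asym Airr] _ _] := Atree.
have uv : u != v by apply: contraTneq Avu => ->; apply: Airr.
set B := branch A v u; have [vB pB] : pendant A v B := branch_pendant A uv.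
pose g := restr B (fun=> 1 : R).
have gB i : g i = (i \in B)%:R by rewrite /g /restr; case: ifP.
have gnorm : sqnorm g = #|B|%:R.
  rewrite -sum1_card natr_sum big_mkcond; apply: eq_bigr => i _.
  by rewrite gB; case: ifP => _; rewrite ?expr1n // expr0n.
have := good g; rewrite gB (negPf vB) gnorm => /(_ erefl).
suff -> : energy A g = 2 by lra.
rewrite energyE //; suff -> : \sum_i g i * lapf A g i = 1 by rewrite mulr1.
rewrite (bigD1 u) //= big1 => [|i iu].
  rewrite gB branch_root mul1r addr0 /lapf (bigD1 v) //= big1 => [|k kv].
    by rewrite Asym Avu !gB branch_root (negPf vB) subr0 mul1r addr0.
  have [Auk|] := boolP (A u k); last by rewrite mul0r.
  by rewrite !gB branch_root (pB u k) ?branch_root // subrr mulr0.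
rewrite gB; have [iB|] := boolP (i \in B); last by rewrite mul0r.
rewrite mul1r /lapf big1 // => k _; have [Aik|] := boolP (A i k); last by rewrite mul0r.
rewrite !gB iB (pB i k) ?subrr ?mulr0 //.
apply: contraNneq iu => kv; rewrite kv Asym in Aik.
by apply/eqP; apply: (branch_neighbor Atree Avu).
Qed.

(** * Branches with at most two vertices *)

Lemma lapf_seq (R : rcfType) (n : nat) (A : rel 'I_n) (f : 'I_n -> R) i (s : seq 'I_n) :
  uniq s -> A i =i s -> lapf A f i = \sum_(k <- s) (f i - f k).
Proof.
move=> us As; rewrite big_uniq //= [RHS]big_mkcond; apply: eq_bigr => k _.
by rewrite -As unfold_in; case: (A i k); rewrite ?mul1r ?mul0r.
Qed.

Lemma branch1_neighbors (n : nat) (A : rel 'I_n) v u :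
  is_tree A -> A v u -> #|branch A v u| = 1%N ->
  branch A v u = [set u] /\ A u =i [:: v].
Proof.
move=> [_ [Asym Airr] _ _] Avu /eqP/cards1P[x Bx].
have uv : u != v by apply: contraTneq Avu => ->; apply: Airr.
have ux : u = x by have := branch_root A v u; rewrite Bx inE => /eqP.
rewrite -{}ux in Bx *; split=> // k; rewrite inE unfold_in.
apply/idP/eqP => [Auk|->]; last by rewrite Asym.
have [_ pB] := branch_pendant A uv; apply/eqP; apply: contraT => kv.
have := pB u k (branch_root A v u) Auk kv; rewrite Bx inE => /eqP ku.
by have := Airr u; rewrite -{2}ku Auk.
Qed.

Lemma branch2_neighbors (n : nat) (A : rel 'I_n) v u :
  is_tree A -> A v u -> #|branch A v u| = 2 ->
  exists w, [/\ w != u, w != v, branch A v u = [set u; w], A u =i [:: v; w] & A w =i [:: u]].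
Proof.
move=> Atree Avu B2; have [_ [Asym Airr] Acon _] := Atree.
have uv : u != v by apply: contraTneq Avu => ->; apply: Airr.
have pB' := branch_inner_pendant Atree Avu.
have uB := branch_root A v u; have [vB pB] := branch_pendant A uv.
have [x xB] : exists x, x \in branch A v u :\ u.
  apply/set0Pn; rewrite -card_gt0; have := cardsD1 u (branch A v u).
  by rewrite B2 uB add1n => -[<-].
have [w wB' Auw] := pendant_neighbor Asym Acon pB' xB.
have /andP[wu wB] : (w != u) && (w \in branch A v u) by rewrite -in_setD1.
have wv : w != v by apply: contraNneq vB => wv; rewrite -{1}wv.
have Bs : branch A v u = [set u; w].
  apply/esym/eqP; rewrite eqEcard B2 cards2 eq_sym wu leqnn andbT.
  by apply/subsetP => y; rewrite in_set2 => /orP[/eqP->|/eqP->].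
exists w; split=> // k; rewrite !inE unfold_in.
  apply/idP/orP => [Auk|[/eqP->|/eqP->//]]; last by rewrite Asym.
  have [|kv] := eqVneq k v; [by left|right].
  have := pB u k uB Auk kv; rewrite Bs in_set2 => /orP[/eqP ku|//].
  by have := Airr u; rewrite -{2}ku Auk.
apply/idP/eqP => [Awk|->]; last by rewrite Asym.
have kv : k != v.
  apply: contraNneq wu => kv; rewrite kv Asym in Awk.
  by apply/eqP; apply: branch_neighbor Atree Avu wB Awk.
have := pB w k wB Awk kv; rewrite Bs in_set2 => /orP[/eqP//|/eqP kw].
by have := Airr w; rewrite -{2}kw Awk.
Qed.

Lemma branch_meet (n : nat) (A : rel 'I_n) v u u' w : symmetric A ->
  w \in branch A v u -> w \in branch A v u' -> u' \in branch A v u.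
Proof.
move=> Asym; rewrite !inE => uw; rewrite sym_connect_sym; first exact: connect_trans.
by move=> x y; rewrite Asym [(y != v) && _]andbC.
Qed.

(** Double counting: branches at distinct neighbours of [v] are disjoint and avoid [v]. *)
Lemma sum_branches (n : nat) (A : rel 'I_n) v (N : {set 'I_n}) :
    is_tree A -> (forall u, u \in N -> A v u) ->
  (\sum_(u in N) #|branch A v u| <= n.-1)%N.
Proof.
move=> Atree NA; have [_ [Asym Airr] _ _] := Atree.
have -> : (\sum_(u in N) #|branch A v u| = \sum_w \sum_(u in N) (w \in branch A v u))%N.
  by rewrite exchange_big; apply: eq_bigr => u _; rewrite -sum1_card big_mkcond.
have uv u : u \in N -> u != v by move=> /NA; apply: contraTneq => ->; apply: Airr.
rewrite (bigD1 v) //= big1 ?add0n => [|u /uv/(branch_pendant A)[/negPf->]] //.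
apply: leq_trans (_ : \sum_(w | w != v) 1 <= _)%N; last first.
  by rewrite sum1_card cardC1 card_ord.
apply: leq_sum => w _.
have [/existsP[u /andP[uN wu]]|/existsPn H] := boolP [exists u in N, w \in branch A v u].
  rewrite (bigD1 u) //= wu big1 // => u' /andP[u'N]; apply: contraNeq.
  rewrite eqb0 negbK => wu'.
  apply/eqP; apply: branch_neighbor Atree (NA _ uN) _ (NA _ u'N).
  exact: branch_meet wu wu'.
rewrite big1 // => u uN; have := H u; by rewrite uN /= => /negPf->.
Qed.

(** At most [(n - 1) / 3] branches have three or more vertices. By the dimension bound, some nonzero
    eigenfunction vanishes at [v] and at their roots, hence on all of these branches. It is nonzero
    on a small branch, where the eigenvalue equations constrain [mu]. *)
Lemma small_branches (R : rcfType) (n : nat) (A : rel 'I_n) (mu : R) :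
    is_tree A -> 0 < mu ->
    (forall h, \sum_i h i = 0 -> 2 * mu * sqnorm h <= energy A h) ->
    (2 < \rank (eigenspace (laplacian R A) mu))%N ->
    (n.-1 < 3 * (\rank (eigenspace (laplacian R A) mu)).-1)%N ->
  exists v,
    mu = 1 /\ (forall u, A v u -> #|branch A v u| = 1%N) \/
    [/\ mu ^+ 2 - 3 * mu + 1 = 0, forall u, A v u -> (#|branch A v u| <= 2)%N
      & exists2 u, A v u & #|branch A v u| = 2].
Proof.
move=> Atree mu_gt0 ray m_gt2 m_big; have [_ [Asym Airr] Acon _] := Atree.
have [v good] := exists_center Atree ray m_gt2; exists v.
pose N := [set u | A v u && (2 < #|branch A v u|)%N].
have cN : (3 * #|N| <= n.-1)%N.
  apply: leq_trans (@sum_branches n A v N Atree _); last first.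
    by move=> u; rewrite inE => /andP[].
  rewrite mulnC -sum_nat_const; apply: leq_sum => u; rewrite inE => /andP[_] //.
have [|f [fE [i fi] f0]] := @eigfun_exists R n A mu (v |: N) Asym.
  have : (#|v |: N| <= #|N|.+1)%N by rewrite cardsU1 -add1n leq_add2r leq_b1.
  by move/leq_ltn_trans; apply; move: #|N| cN; lia.
have fv : f v = 0 by apply: f0; rewrite !inE eqxx.
have iv : i != v by apply: contraNneq fi => ->; rewrite fv.
have [u Avu iu] := branch_cover Acon iv.
have uv : u != v by apply: contraTneq Avu => ->; apply: Airr.
have fu : f u != 0.
  by apply: contraNneq fi => fu; rewrite (center_branch_zero Asym good fE fv fu iu).
have cB : (#|branch A v u| <= 2)%N.
  by rewrite leqNgt; apply: contraNN fu => cB; rewrite f0 // !inE Avu cB orbT.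
have cB0 : (0 < #|branch A v u|)%N by rewrite (cardD1 u) branch_root.
have [B1|B2] : #|branch A v u| = 1%N \/ #|branch A v u| = 2 by lia.
  left; have [_ Au] := branch1_neighbors Atree Avu B1.
  have mu1 : mu = 1.
    have := fE u; rewrite (lapf_seq f _ Au) // big_seq1 fv subr0 => e.
    by apply: (mulIf fu); rewrite -e mul1r.
  split=> // x Avx; have := center_branch_card Atree good Avx.
  rewrite mu1 mul1r lern1; have : (0 < #|branch A v x|)%N by rewrite (cardD1 x) branch_root.
  lia.
right; have [w [wu wv _ Au Aw]] := branch2_neighbors Atree Avu B2.
(* Eliminating [f w] from the equations at [u] and [w] leaves the quadratic times [f u]. *)
have quad : mu ^+ 2 - 3 * mu + 1 = 0.
  have := fE u; rewrite (lapf_seq f _ Au) /=; last by rewrite inE eq_sym wv.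
  have := fE w; rewrite (lapf_seq f _ Aw) // big_seq1 big_cons big_seq1 fv => ew eu.
  have fw : f w = (2 - mu) * f u by lra.
  by apply: (mulIf fu); rewrite fw in ew; lra.
split=> [//|x Avx|]; last by exists u.
have := center_branch_card Atree good Avx; rewrite leqNgt => H; apply/negP => c3.
(* With [3 * mu <= 1] the quadratic would give [mu ^+ 2 <= 0]. *)
have : mu * 3 <= mu * #|branch A v x|%:R by rewrite ler_pM2l // ler_nat.
nra.
Qed.

(** Such a tree is a star, and functions of sum zero vanishing at its centre are eigenfunctions for
    [1]; the columns of [C] encode these two conditions. This large multiplicity later rules out
    [mu = 1]. *)
Lemma star_mult (R : rcfType) (n : nat) (A : rel 'I_n) v :
    is_tree A -> (forall u, A v u -> #|branch A v u| = 1%N) ->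
  (n - 2 <= \rank (eigenspace (laplacian R A) 1))%N.
Proof.
move=> Atree B1; have [_ [Asym Airr] Acon _] := Atree.
pose C : 'M[R]_(n, 1 + 1) := row_mx (const_mx 1) (\col_i (i == v)%:R).
have Av : A v =1 predC1 v.
  move=> u /=; apply/idP/idP => [|uv]; first by apply: contraTneq => ->; apply: Airr.
  have [w Avw uw] := branch_cover Acon uv.
  have [Bw _] := branch1_neighbors Atree Avw (B1 w Avw).
  by move: uw; rewrite Bw inE => /eqP->.
have rkC : (n - 2 <= \rank (kermx C))%N by rewrite mxrank_ker; have := rank_leq_col C; lia.
apply: leq_trans rkC _; apply: mxrankS; apply/rV_subP => x /sub_kermxP.
rewrite mul_mx_row -[0]hsubmxK => /eq_row_mx[/rowP/(_ 0) xs /rowP/(_ 0) xv].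
have {}xs : \sum_i x 0 i = 0.
  by move: xs; rewrite !mxE => e; rewrite -[RHS]e; apply: eq_bigr => i _; rewrite mxE mulr1.
have {}xv : x 0 v = 0.
  move: xv; rewrite !mxE (bigD1 v) //= mxE eqxx mulr1 big1 ?addr0 // => i iv.
  by rewrite mxE (negPf iv) mulr0.
apply/eigfunP => // i; rewrite mul1r; have [->|iv] := eqVneq i v.
  transitivity (- \sum_k x 0 k); last by rewrite xs xv oppr0.
  rewrite /lapf (bigD1 v) //= [in RHS](bigD1 v) //= subrr mulr0 xv !add0r -sumrN.
  by apply: eq_bigr => k kv; rewrite Av /= kv mul1r sub0r.
have Avi : A v i by rewrite Av.
have [_ Ai] := branch1_neighbors Atree Avi (B1 i Avi).
by rewrite (lapf_seq _ _ Ai) // big_seq1 xv subr0.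
Qed.

(** * Spiders *)

(** The permutation matrix of the isomorphism conjugates the Laplacians. *)
Lemma isomorphic_charpoly (R : rcfType) (n m : nat) (A : rel 'I_n) (B : rel 'I_m) :
  isomorphic A B -> lap_charpoly R A = lap_charpoly R B.
Proof.
move=> [f [fbij fAB]].
have nm : n = m by have := bij_eq_card fbij; rewrite !card_ord.
subst m; pose p := perm (bij_inj fbij).
have pE i : p i = f i by rewrite permE.
apply/esym; rewrite /lap_charpoly.
apply: (@char_poly_conj _ _ (perm_mx p)); first exact: unitmx_perm.
rewrite -row_permE -[p in RHS]invgK -col_permE.
apply/matrixP => i k; rewrite !mxE; set l := fun_of_perm _ k.
have kl : k = f l by rewrite -pE /l permKV.
rewrite kl pE fAB (inj_eq (bij_inj fbij)); congr ((if _ then _%:R else _) - _).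
rewrite -[RHS](card_imset _ (bij_inj fbij)); apply: eq_card => y.
by have [g fK gK] := fbij; rewrite -(gK y) (mem_imset _ _ (bij_inj fbij)) !inE fAB.
Qed.

Lemma isomorphic_lap_mult (R : rcfType) (n m : nat) (A : rel 'I_n) (B : rel 'I_m) (mu : R) :
  isomorphic A B -> lap_mult A mu = lap_mult B mu.
Proof. by move=> AB; rewrite /lap_mult (isomorphic_charpoly R AB). Qed.

Lemma isomorphic_alg_conn (R : rcfType) (n m : nat) (A : rel 'I_n) (B : rel 'I_m) :
  isomorphic A B -> alg_conn R A = alg_conn R B.
Proof.
by move=> AB; rewrite /alg_conn /lap_eig /lap_spectrum /lap_mult (isomorphic_charpoly R AB).
Qed.

Lemma lap_multE (R : rcfType) (n : nat) (A : rel 'I_n) (mu : R) :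
  symmetric A -> lap_mult A mu = \rank (eigenspace (laplacian R A) mu).
Proof. by move=> Asym; apply: mup_symmetric; apply: laplacian_sym. Qed.

(** [inord] needs a bound in successor form, whence the cast; the index is meaningful only up to
    [s + k]. *)
Definition vtx (s k i : nat) : 'I_(s + k + 1) := cast_ord (esym (addn1 (s + k))) (inord i).

Lemma vtxE s k i : (i <= s + k)%N -> vtx s k i = i :> nat.
Proof. by move=> ile; rewrite /= inordK. Qed.

Lemma vtxK s k (x : 'I_(s + k + 1)) : vtx s k x = x.
Proof. by apply: ord_inj; rewrite vtxE //; have := ltn_ord x; lia. Qed.

Lemma spider_sym s k : symmetric (spider s k).
Proof. by move=> x y; rewrite /spider orbC. Qed.

Lemma spider_irr s k x : (k <= s)%N -> spider s k x x = false.
Proof. by move=> ks; rewrite /spider /spider_edge; lia. Qed.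

(** A long ray [i <= k] consists of the knee [vtx s k i] and the foot [vtx s k (s + i)]; a short ray
    [k < i <= s] is a single leaf. *)
Lemma spider_foot s k i : (k <= s)%N -> (0 < i <= k)%N ->
  spider s k (vtx s k (s + i)) =i [:: vtx s k i].
Proof.
move=> ks ik x; rewrite inE unfold_in /spider /spider_edge -val_eqE /=.
rewrite !inordK; lia.
Qed.

Lemma spider_knee s k i : (k <= s)%N -> (0 < i <= k)%N ->
  spider s k (vtx s k i) =i [:: vtx s k 0; vtx s k (s + i)].
Proof.
move=> ks ik x; rewrite !inE unfold_in /spider /spider_edge -!val_eqE /=.
rewrite !inordK; lia.
Qed.

Lemma spider_leaf s k i : (k <= s)%N -> (k < i <= s)%N ->
  spider s k (vtx s k i) =i [:: vtx s k 0].
Proof.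
move=> ks ik x; rewrite !inE unfold_in /spider /spider_edge -!val_eqE /=.
rewrite !inordK; lia.
Qed.

Lemma spider_vertexP s k (P : 'I_(s + k + 1) -> Prop) : (k <= s)%N ->
    P (vtx s k 0) -> (forall i, (0 < i <= k)%N -> P (vtx s k i) /\ P (vtx s k (s + i))) ->
    (forall i, (k < i <= s)%N -> P (vtx s k i)) ->
  forall x, P x.
Proof.
move=> ks P0 Pl Pk x; rewrite -(vtxK x); have := ltn_ord x.
have [->//|x0] := posnP x; have [xk _|kx] := leqP x k; first by apply Pl; lia.
have [xs _|sx xsk] := leqP x s; first by apply Pk; lia.
have -> : (x : nat) = (s + (x - s))%N by lia.
by apply Pl; lia.
Qed.

Lemma spider_connected s k : (k <= s)%N -> connected_graph (spider s k).
Proof.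
move=> ks; have symc := sym_connect_sym (@spider_sym s k).
suff to0 x : connect (spider s k) x (vtx s k 0).
  by move=> x y; apply: connect_trans (to0 x) _; rewrite symc.
move: x; apply: (spider_vertexP ks) => [|i ik|i ik]; first exact: connect0.
  have c1 : connect (spider s k) (vtx s k i) (vtx s k 0).
    by apply: connect1; have := spider_knee ks ik (vtx s k 0); rewrite !inE eqxx.
  split=> //; apply: connect_trans c1; apply: connect1.
  by have := spider_foot ks ik (vtx s k i); rewrite !inE eqxx.
by apply: connect1; have := spider_leaf ks ik (vtx s k 0); rewrite !inE eqxx.
Qed.

Lemma vtx_inj s k i j : (i <= s + k)%N -> (j <= s + k)%N ->
  (vtx s k i == vtx s k j) = (i == j).
Proof. by move=> ile jle; rewrite -(inj_eq (@ord_inj _)) !vtxE. Qed.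

(** * The spectrum of a spider *)

Lemma spider_lapf (R : rcfType) s k (f : 'I_(s + k + 1) -> R) : (k <= s)%N ->
  let F i := f (vtx s k i) in let l i := lapf (spider s k) f (vtx s k i) in
  (forall i, (0 < i <= k)%N ->
     l i = 2 * F i - F 0%N - F (s + i)%N /\ l (s + i)%N = F (s + i)%N - F i) /\
  (forall i, (k < i <= s)%N -> l i = F i - F 0%N).
Proof.
move=> ks F l; split=> i ik; last by rewrite /l (lapf_seq f _ (spider_leaf ks ik)) // big_seq1.
rewrite /l (lapf_seq f _ (spider_knee ks ik)) ?(lapf_seq f _ (spider_foot ks ik)) //.
  by rewrite big_cons !big_seq1 /F; split; ring.
by rewrite /= inE vtx_inj //; lia.
Qed.

(** When [th ^+ 2 - 3 * th + 1 = 0], the eigenvalue equation for [th] holds except at the centre,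
    where the defect does not depend on [a]. Differences of two such functions are therefore
    eigenfunctions. *)
Definition leg_fun (R : rcfType) s k (th : R) (a : nat) (x : 'I_(s + k + 1)) : R :=
  (x == a :> nat)%:R * (1 - th) + (x == (s + a)%N :> nat)%:R.

Lemma lapf_leg_fun (R : rcfType) s k (th : R) a :
    (k <= s)%N -> (0 < a <= k)%N -> th ^+ 2 - 3 * th + 1 = 0 ->
  forall x, lapf (spider s k) (@leg_fun R s k th a) x =
    th * leg_fun th a x - (1 - th) * (x == 0%N :> nat)%:R.
Proof.
move=> ks ak quad; have [Hl Hk] := spider_lapf (@leg_fun R s k th a) ks.
have E i : (i <= s + k)%N -> leg_fun th a (vtx s k i) =
    (i == a)%:R * (1 - th) + (i == (s + a)%N)%:R by move=> ile; rewrite /leg_fun vtxE.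
have E0 : leg_fun th a (vtx s k 0) = 0.
  have -> : leg_fun th a (vtx s k 0) = (0 == a)%N%:R * (1 - th) + (0 == s + a)%N%:R by apply: E.
  have -> : (0 == a)%N = false by lia.
  have -> : (0 == s + a)%N = false by lia.
  by rewrite mul0r addr0.
apply: (spider_vertexP ks) => [|i ik|i ik].
- rewrite E0 vtxE // eqxx mulr1 mulr0 sub0r /lapf (bigD1 (vtx s k a)) //= big1.
    have -> : spider s k (vtx s k 0) (vtx s k a).
      by have := spider_knee ks ak (vtx s k 0); rewrite !inE eqxx spider_sym.
    rewrite E0 E ?eqxx; last by lia.
    have -> : (a == s + a)%N = false by lia.
    rewrite /=; ring.
  move=> x xa; rewrite E0; have [ax|] := boolP (spider _ _ _ x); last by rewrite mul0r.
  have xa' : (x == a :> nat) = false.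
    by apply/negbTE; move: xa; rewrite -(inj_eq (@ord_inj _)) vtxE //; lia.
  have xs : (x == (s + a)%N :> nat) = false.
    by apply/negbTE; move: ax; rewrite /spider /spider_edge vtxE //; lia.
  by rewrite /leg_fun xa' xs mul0r addr0 subrr mulr0.
- have [-> ->] := Hl i ik; rewrite E0 !E; try lia.
  rewrite !vtxE; try lia.
  have -> : (i == s + a)%N = false by lia.
  have -> : (s + i == a)%N = false by lia.
  have -> : (i == 0)%N = false by lia.
  have -> : (s + i == 0)%N = false by lia.
  rewrite eqn_add2l.
  by case: eqP => _; split; rewrite /=; nra.
- rewrite Hk // E0 !E ?vtxE; try lia.
  have -> : (i == a)%N = false by lia.
  have -> : (i == s + a)%N = false by lia.
  have -> : (i == 0)%N = false by lia.
  rewrite /=; ring.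
Qed.

(** Upper bound: an eigenfunction vanishing at the feet of rays [1] to [k - 1] is zero. Lower bound:
    the differences of [leg_fun] between each ray below [k] and ray [k] are independent. *)
Lemma spider_mult (R : rcfType) s k (th : R) :
    (0 < k <= s)%N -> th ^+ 2 - 3 * th + 1 = 0 ->
  \rank (eigenspace (laplacian R (spider s k)) th) = k.-1.
Proof.
move=> /andP[k0 ks] quad; have th1 : 1 - th != 0.
  apply/negP => /eqP e; have e1 : th = 1 by lra.
  by move: quad; rewrite e1 expr1n; lra.
apply/eqP; rewrite eqn_leq; apply/andP; split.
  pose D := [set vtx s k (s + i.+1) | i : 'I_k.-1].
  have cD : (#|D| <= k.-1)%N by apply: leq_trans (leq_imset_card _ _) _; rewrite card_ord.
  apply: leq_trans cD; apply: rank_eig_le; first exact: spider_sym.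
  move=> f fE fD; have [Hl Hk] := spider_lapf f ks; pose F i := f (vtx s k i).
  have {}Hl i : (0 < i <= k)%N ->
      th * F i = 2 * F i - F 0%N - F (s + i)%N /\ th * F (s + i)%N = F (s + i)%N - F i.
    by move=> /Hl[]; rewrite !fE.
  have {}Hk i : (k < i <= s)%N -> th * F i = F i - F 0%N by move=> /Hk; rewrite !fE.
  have F0E : f (vtx s k 0) = F 0%N by [].
  have kk : (0 < k <= k)%N by lia.
  (* The knee and foot equations make the value at the centre equal to the quadratic in [th] times
     the value at the foot. *)
  have f0 : F 0%N = 0.
    have [] := Hl k kk => e1 e2.
    have e3 : F k = (1 - th) * F (s + k)%N by lra.
    have -> : F 0%N = (th ^+ 2 - 3 * th + 1) * F (s + k)%N by rewrite e3 in e1; lra.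
    by rewrite quad mul0r.
  have fl i : (0 < i < k)%N -> F i = 0 /\ F (s + i)%N = 0.
    move=> ik; have ik' : (0 < i <= k)%N by lia.
    have e0 : F (s + i)%N = 0.
      have ik1 : (i.-1 < k.-1)%N by lia.
      apply: fD; apply/imsetP; exists (Ordinal ik1) => //=; congr (vtx _ _ (_ + _)); lia.
    have [_] := Hl i ik'; rewrite e0; split=> //; lra.
  have fk i : (k < i <= s)%N -> F i = 0.
    move=> ik; have := Hk i ik; rewrite f0 => e.
    by apply: (mulfI th1); lra.
  (* In the equation at the centre every ray other than [k] contributes zero. *)
  have Fk : F k = 0.
    have := fE (vtx s k 0); rewrite F0E f0 mulr0 /lapf (bigD1 (vtx s k k)) //= big1.
      have -> : spider s k (vtx s k 0) (vtx s k k).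
        by have := spider_knee ks kk (vtx s k 0); rewrite !inE eqxx spider_sym.
      rewrite mul1r F0E -/(F k) f0; lra.
    move=> x xk; have [ax|] := boolP (spider _ _ _ x); last by rewrite mul0r.
    have fx : f x = 0.
      rewrite -(vtxK x) -/(F x).
      move: ax xk; rewrite /spider /spider_edge -(inj_eq (@ord_inj _)) !vtxE //; last by lia.
      move=> ax xk; have [xk'|kx] := leqP x k; first by apply fl; lia.
      by apply: fk; lia.
    by rewrite fx F0E f0 subrr mulr0.
  apply: (spider_vertexP ks) => [//|i ik|i ik]; last exact: fk.
  rewrite -/(F i) -/(F (s + i)%N); have [ik'|ik'] : (0 < i < k)%N \/ i = k by lia.
    exact: fl.
  rewrite ik' Fk; split=> //; have [_] := Hl k kk.
  rewrite Fk => e; apply: (mulfI th1); lra.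
pose W : 'M[R]_(k.-1, s + k + 1) := \matrix_(i, x) (leg_fun th i.+1 x - leg_fun th k x).
have WE : (W <= eigenspace (laplacian R (spider s k)) th)%MS.
  apply/row_subP => i; apply/eigfunP; first exact: spider_sym.
  move=> x; rewrite !mxE mulrBr.
  have := ltn_ord i => ik.
  have i1k : (0 < i.+1 <= k)%N by lia.
  have kk : (0 < k <= k)%N by lia.
  have := lapf_leg_fun ks i1k quad x; have := lapf_leg_fun ks kk quad x => e1 e2.
  transitivity (lapf (spider s k) (@leg_fun R s k th i.+1) x -
                lapf (spider s k) (@leg_fun R s k th k) x); last by rewrite e1 e2; ring.
  rewrite /lapf -sumrB; apply: eq_bigr => y _; rewrite !mxE; ring.
apply: leq_trans (mxrankS WE).
(* Evaluated at the feet of rays [1] to [k - 1], the rows of [W] form the identity matrix. *)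
have WI : colsub (fun j : 'I_k.-1 => vtx s k (s + j.+1)) W = 1%:M.
  apply/matrixP => i j; rewrite !mxE /leg_fun vtxE; last by have := ltn_ord j; lia.
  have := ltn_ord i; have := ltn_ord j => jk ik.
  rewrite !(eqn_add2l s) eqSS.
  have -> : (s + j.+1 == i.+1)%N = false by lia.
  have -> : (s + j.+1 == k)%N = false by lia.
  have -> : (j.+1 == k)%N = false by lia.
  by rewrite /= !mul0r !add0r subr0 eq_sym.
rewrite -[X in (X <= _)%N](mxrank1 R) -WI -[W in colsub _ W]mulmx1 -mulmx_colsub.
exact: mxrankM_maxl.
Qed.

Lemma spider_alg_conn (R : rcfType) s k : (1 < k <= s)%N ->
  let mu := alg_conn R (spider s k) in mu ^+ 2 - 3 * mu + 1 = 0.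
Proof.
move=> /andP[k1 ks] mu; have ssym := @spider_sym s k; have scon := spider_connected ks.
have n1 : (1 < s + k + 1)%N by lia.
have [mu_gt0 mu_eig _] := alg_conn_spec R ssym scon n1; rewrite -/mu in mu_gt0 mu_eig.
pose r := Num.sqrt (5 : R); have r2 : r ^+ 2 = 5 by rewrite sqr_sqrtr.
have r0 : 0 <= r by apply: sqrtr_ge0.
pose th := (3 - r) / 2.
have quad : th ^+ 2 - 3 * th + 1 = 0 by rewrite /th; lra.
have r1 : 1 < r by nra.
have r3 : r < 3 by nra.
have th0 : 0 < th by rewrite /th; lra.
have th1 : th < 1 by rewrite /th; lra.
(* As [k > 1], [th] has positive multiplicity; its eigenfunctions sum to zero, so the Rayleigh bound
   applies to them. *)
have mu_le : mu <= th.
  have [|f [fE [i fi] _]] := @eigfun_exists R _ _ th set0 ssym.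
    by rewrite cards0 spider_mult //; lia.
  have f0 := eigfun_sum0 ssym (lt0r_neq0 th0) fE.
  have := alg_conn_rayleigh ssym scon n1 f0; rewrite (energy_eigfun ssym fE).
  by rewrite ler_pM2r ?(sqnorm_gt0 fi) // ler_pM2l.
have [->//|mu_th] := eqVneq mu th; have {mu_th} mu_lt : mu < th by rewrite lt_neqAle mu_th.
have [f fE [i fi]] := (eigenvalue_eigfun mu ssym).1 mu_eig.
have f0 := eigfun_sum0 ssym (lt0r_neq0 mu_gt0) fE.
have P_gt0 : 0 < mu ^+ 2 - 3 * mu + 1.
  (* The other root of the quadratic is [3 - th]. *)
  have -> : mu ^+ 2 - 3 * mu + 1 = (th - mu) * (3 - th - mu) by lra.
  by apply: mulr_gt0; lra.
have mu1 : 0 < 1 - mu by lra.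
have [Hl Hk] := spider_lapf f ks; pose F i := f (vtx s k i).
have {}Hl l : (0 < l <= k)%N -> F l = (1 - mu) * F (s + l)%N /\
    F 0%N = (mu ^+ 2 - 3 * mu + 1) * F (s + l)%N.
  move=> /Hl[]; rewrite !fE -/(F l) -/(F (s + l)%N) -/(F 0%N) => e1 e2.
  have e3 : F l = (1 - mu) * F (s + l)%N by lra.
  by split=> //; rewrite e3 in e1; lra.
have {}Hk l : (k < l <= s)%N -> F 0%N = (1 - mu) * F l.
  by move=> /Hk; rewrite fE -/(F l) -/(F 0%N) => e; lra.
(* Below [th] all factors relating the other values to the central one are positive. Since [f] sums
   to zero, the central value vanishes, and then [f] does. *)
have same_sign x : 0 <= F 0%N * f x.
  move: x; apply: (spider_vertexP ks) => [|l lk|l lk].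
  - by rewrite -/(F 0%N) -expr2 sqr_ge0.
  - have [e1 e2] := Hl l lk; rewrite -/(F l) -/(F (s + l)%N) e1 e2.
    have sq := sqr_ge0 (F (s + l)%N); rewrite expr2 in sq.
    split; first by rewrite mulrACA pmulr_rge0 ?mulr_gt0.
    by rewrite -mulrA pmulr_rge0.
  - rewrite -/(F l) (Hk l lk) -mulrA pmulr_rge0 // -expr2; exact: sqr_ge0.
have F0 : F 0%N = 0.
  have : \sum_x F 0%N * f x = 0 by rewrite -mulr_sumr f0 mulr0.
  move=> /eqP; rewrite psumr_eq0 // => /allP/(_ (vtx s k 0) (mem_index_enum _)) /=.
  by rewrite -/(F 0%N) mulf_eq0 orbb => /eqP.
suff : f i = 0 by move=> e; rewrite e eqxx in fi.
move: (i); apply: (spider_vertexP ks) => [//|l lk|l lk].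
  have [e1 e2] := Hl l lk; have el : F (s + l)%N = 0.
    by apply: (mulfI (lt0r_neq0 P_gt0)); rewrite -e2 F0 mulr0.
  by split=> //; rewrite -/(F l) e1 el mulr0.
by apply: (mulfI (lt0r_neq0 mu1)); rewrite -/(F l) -(Hk l lk) F0 mulr0.
Qed.

(** * Recognising a spider by its branches *)

Lemma tree_spider (n : nat) (A : rel 'I_n) v :
    is_tree A -> (forall u, A v u -> (#|branch A v u| <= 2)%N) ->
    (exists2 u, A v u & #|branch A v u| = 2) ->
  exists s k, [/\ (0 < k <= s)%N, n = (s + k + 1)%N & isomorphic A (spider s k)].
Proof.
move=> Atree B2 [u0 Avu0 Bu0]; have [_ [Asym Airr] Acon _] := Atree.
pose p b := [pred u | A v u && (#|branch A v u| == b)].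
(* Roots of two-vertex branches come first, because the long rays of the spider are numbered [1] to
   [k]. *)
pose l1 := enum (p 2); pose l := l1 ++ enum (p 1%N).
(* The default is never reached for roots in [l1], whose branch has a second vertex. *)
pose foot u := odflt u [pick w in branch A v u :\ u].
have lE u : (u \in l) = A v u.
  rewrite mem_cat !mem_enum !inE -andb_orr; case: (boolP (A v u)) => //= Avu.
  have : (0 < #|branch A v u|)%N by rewrite (cardD1 u) branch_root.
  by move: (B2 u Avu); case: #|branch A v u| => [|[|[|c]]].
have ul : uniq l.
  rewrite cat_uniq !enum_uniq andbT /=; apply/hasPn => u; rewrite !mem_enum !inE.
  by move=> /andP[_ /eqP->]; rewrite andbF.
have nv u : u \in l -> u != v by rewrite lE; apply: contraTneq => ->; apply: Airr.
have footP u : u \in l1 -> [/\ foot u != u, foot u != v, branch A v u = [set u; foot u],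
    A u =i [:: v; foot u] & A (foot u) =i [:: u]].
  rewrite mem_enum inE => /andP[Avu /eqP Bu].
  have [w [wu wv Bw Au Aw]] := branch2_neighbors Atree Avu Bu.
  suff -> : foot u = w by [].
  rewrite /foot; case: pickP => [x|/(_ w)].
    by rewrite /= Bw !inE => /andP[/negPf->] /= /eqP.
  by rewrite /= Bw !inE wu eqxx orbT.
(* The lengths are abstracted so that [s] and [k] stay variables in ['I_(s + k + 1)]. *)
have [s sE] : {s | s = size l} by exists (size l).
have [k kE] : {k | k = size l1} by exists (size l1).
have ks : (k <= s)%N by rewrite sE kE size_cat leq_addr.
have k0 : (0 < k)%N.
  by rewrite kE -has_predT; apply/hasP; exists u0; rewrite ?mem_enum ?inE ?Avu0 ?Bu0.
(* Rays are numbered from [1], list entries from [0]. *)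
pose ray i := nth v l i.-1.
have rayl i : (0 < i <= s)%N -> ray i \in l by move=> ik; apply: mem_nth; rewrite -sE; lia.
have ray1 i : (0 < i <= k)%N -> ray i \in l1.
  move=> ik; rewrite /ray nth_cat -kE (_ : (i.-1 < k)%N = true); last by lia.
  by apply: mem_nth; rewrite -kE; lia.
have ray2 i : (k < i <= s)%N -> A (ray i) =i [:: v].
  move=> ik; have : ray i \in enum (p 1%N).
    rewrite /ray nth_cat -kE (_ : (i.-1 < k)%N = false); last by lia.
    have := sE; rewrite size_cat -kE => e; apply: mem_nth; move: (size _) e => c e; lia.
  rewrite mem_enum inE => /andP[Avu /eqP Bu].
  by case: (branch1_neighbors Atree Avu Bu).
have ray_inj i j : (0 < i <= s)%N -> (0 < j <= s)%N -> ray i = ray j -> i = j.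
  move=> ik jk /eqP; rewrite nth_uniq // -?sE; lia.
pose g (i : nat) := if i == 0%N then v else if (i <= s)%N then ray i else foot (ray (i - s)%N).
have g0 : g 0%N = v by [].
have gray i : (0 < i <= s)%N -> g i = ray i.
  by rewrite /g => /andP[i0 ->]; rewrite gtn_eqF.
have gfoot i : (0 < i <= k)%N -> g (s + i)%N = foot (ray i).
  move=> ik; rewrite /g; have -> : (s + i == 0)%N = false by lia.
  by have -> : (s + i <= s)%N = false; [lia|rewrite addKn].
pose h (x : 'I_(s + k + 1)) := g x.
have hv i : (i <= s + k)%N -> h (vtx s k i) = g i by move=> ile; rewrite /h vtxE.
have rs i : (0 < i <= k)%N -> (0 < i <= s)%N by lia.
have h0 : h (vtx s k 0) = v by rewrite hv.
have hray i : (0 < i <= s)%N -> h (vtx s k i) = ray i.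
  by move=> ik; rewrite hv; [apply: gray|lia].
have hfoot i : (0 < i <= k)%N -> h (vtx s k (s + i)) = foot (ray i).
  by move=> ik; rewrite hv; [apply: gfoot|lia].
(* Away from the centre the neighbour lists correspond under [h]; edges at the centre then follow by
   symmetry. *)
have hnbr x : x != vtx s k 0 ->
    exists q, spider s k x =i q /\ A (h x) =i map h q.
  move: x; apply: (spider_vertexP ks) => [|i ik|i ik]; first by rewrite eqxx.
    have [_ _ _ Ar Af] := footP _ (ray1 i ik); have is' := rs i ik; split=> _.
      exists [:: vtx s k 0; vtx s k (s + i)]; split; first exact: spider_knee.
      by rewrite /= h0 (hray i) // hfoot.
    exists [:: vtx s k i]; split; first exact: spider_foot.
    by rewrite /= (hray i) // hfoot.
  move=> _; exists [:: vtx s k 0]; split; first exact: spider_leaf.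
  by rewrite /= h0 (hray i); [apply: ray2|lia].
have kind x : [\/ x = vtx s k 0 /\ h x = v,
    exists i, [/\ (0 < i <= s)%N, x = vtx s k i & h x = ray i] |
    exists i, [/\ (0 < i <= k)%N, x = vtx s k (s + i) & h x = foot (ray i)]].
  move: x; apply: (spider_vertexP ks) => [|i ik|i ik].
  - by constructor 1.
  - have is' := rs i ik.
    by split; [constructor 2|constructor 3]; exists i; split=> //; [apply: hray|apply: hfoot].
  - have is' : (0 < i <= s)%N by lia.
    by constructor 2; exists i; split=> //; apply: hray.
have footNl i : (0 < i <= k)%N -> foot (ray i) \notin l.
  move=> ik; have [_ _ _ _ Af] := footP _ (ray1 i ik).
  rewrite lE Asym; have := Af v; rewrite unfold_in inE => ->.
  by rewrite eq_sym; apply/nv/rayl/rs.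
have footNv i : (0 < i <= k)%N -> foot (ray i) != v.
  by move=> ik; have [] := footP _ (ray1 i ik).
have foot_inj i i' : (0 < i <= k)%N -> (0 < i' <= k)%N ->
    foot (ray i) = foot (ray i') -> i = i'.
  move=> ik ik' e; apply: ray_inj; [exact: rs|exact: rs|].
  have [_ _ _ _ Af] := footP _ (ray1 i ik); have [_ _ _ _ Af'] := footP _ (ray1 i' ik').
  by have := Af' (ray i); rewrite -e Af !inE eqxx => /esym/eqP.
have hinj : injective h.
  move=> x y; case: (kind x) => [[-> ->]|[i [ik -> ->]]|[i [ik -> ->]]];
    case: (kind y) => [[-> ->]|[i' [ik' -> ->]]|[i' [ik' -> ->]]] // e.
  - by have := nv _ (rayl _ ik'); rewrite -e eqxx.
  - by have := footNv _ ik'; rewrite -e eqxx.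
  - by have := nv _ (rayl _ ik); rewrite e eqxx.
  - by rewrite (ray_inj _ _ ik ik' e).
  - by have := footNl _ ik'; rewrite -e (rayl _ ik).
  - by have := footNv _ ik; rewrite e eqxx.
  - by have := footNl _ ik; rewrite e (rayl _ ik').
  - by rewrite (foot_inj _ _ ik ik' e).
have hsurj z : exists x, h x = z.
  have [->|zv] := eqVneq z v; first by exists (vtx s k 0).
  have [u Avu zu] := branch_cover Acon zv.
  have ul' : u \in l by rewrite lE.
  have iu : (0 < (index u l).+1 <= s)%N by rewrite sE /= index_mem.
  have ru : ray (index u l).+1 = u by rewrite /ray /= nth_index.
  have [zu'|zu'] := eqVneq z u.
    by exists (vtx s k (index u l).+1); rewrite hray // ru.
  have [B1|Bu] : #|branch A v u| = 1%N \/ #|branch A v u| = 2.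
  - have : (0 < #|branch A v u|)%N by rewrite (cardD1 u) branch_root.
    by have := B2 u Avu; lia.
  - have [Bs _] := branch1_neighbors Atree Avu B1.
    by move: zu zu'; rewrite Bs inE => ->.
  have u1 : u \in l1 by rewrite mem_enum inE Avu Bu eqxx.
  have [_ _ Bs _ _] := footP u u1.
  have ik : (0 < (index u l).+1 <= k)%N by rewrite kE /= index_cat u1 index_mem.
  exists (vtx s k (s + (index u l).+1)); rewrite hfoot // ru.
  by move: zu; rewrite Bs !inE (negPf zu') => /eqP.
have hbij : bijective h.
  apply: inj_card_bij => //; apply: leq_trans (leq_image_card h predT).
  apply: subset_leq_card; apply/subsetP => z _; have [x <-] := hsurj z.
  exact: codom_f.
have hA x y : spider s k x y = A (h x) (h y).
  have H x' y' : x' != vtx s k 0 -> spider s k x' y' = A (h x') (h y').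
    move=> /hnbr[q [e1 e2]]; rewrite -[LHS]/(y' \in spider s k x').
    by rewrite -[RHS]/(h y' \in A (h x')) e1 e2 (mem_map hinj).
  have [->|/H//] := eqVneq x (vtx s k 0).
  have [->|/H e] := eqVneq y (vtx s k 0); last by rewrite spider_sym Asym.
  by rewrite spider_irr // h0 (negPf (Airr v)).
exists s, k; split; first by rewrite k0.
  by have := bij_eq_card hbij; rewrite !card_ord.
have [h' hK h'K] := hbij; exists h'; split; first by exists h.
by move=> x y; rewrite hA !h'K.
Qed.

(** * Trees with the prescribed multiplicity *)

Theorem theorem4p4 (R : rcfType) (j n : nat) (T : rel 'I_n) :
  (2 <= j)%N -> (10 * j < n)%N -> is_tree T ->
  (lap_mult T (alg_conn R T) = n./2 - j)%N <->
  isomorphic T (spider (uphalf n + j - 2) (n./2 - j + 1)).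
Proof.
move=> j2 jn Ttree; have [_ [Tsym Tirr] Tcon _] := Ttree.
have n2 := odd_double_half n; have up := uphalf_half n.
have b : (odd n <= 1)%N by apply: leq_b1.
split=> [Hm|iso]; last first.
  rewrite (isomorphic_lap_mult _ iso) (isomorphic_alg_conn R iso).
  (* Here [n > 10 * j] ensures [k > 1], as [spider_alg_conn] needs. *)
  have ks : (1 < n./2 - j + 1 <= uphalf n + j - 2)%N by lia.
  rewrite lap_multE; last exact: spider_sym.
  by rewrite spider_mult; [lia|lia|apply: spider_alg_conn].
have n1 : (1 < n)%N by lia.
have [mu_gt0 _ _] := alg_conn_spec R Tsym Tcon n1; set mu := alg_conn R T in Hm mu_gt0.
have ray h : \sum_i h i = 0 -> 2 * mu * sqnorm h <= energy T h.
  exact: alg_conn_rayleigh.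
have rk : \rank (eigenspace (laplacian R T) mu) = (n./2 - j)%N by rewrite -lap_multE.
(* As [n > 10 * j] and [j >= 2], the dimension [n./2 - j] exceeds both [2] and [1 + (n - 1) / 3]. *)
have [||v [[mu1 B1]|[quad B2 exB]]] := small_branches Ttree mu_gt0 ray.
- by rewrite rk; lia.
- by rewrite rk; lia.
(* A star would have multiplicity at least [n - 2], more than [n./2 - j]. *)
- by have := star_mult R Ttree B1; rewrite -mu1 rk; lia.
have [s [k [ks nE iso]]] := tree_spider Ttree B2 exB.
(* The multiplicity [k - 1] and the order [s + k + 1] determine [k] and [s]. *)
have := isomorphic_lap_mult mu iso; rewrite Hm lap_multE; last exact: spider_sym.
rewrite spider_mult // => mk.
have -> : (n./2 - j + 1)%N = k by lia.
by have -> : (uphalf n + j - 2)%N = s by lia.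
Qed.
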